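(* Let $\sigma>0$, let $M>0$ be a constant, let $r,p_1,p_2\ge1$ be integers, and let $\Sigma\in\mathbb{R}^{p_1p_2\times p_1p_2}$ be a covariance matrix satisfying, for some $\kappa,\kappa_u>0$ with $\kappa_u\asymp\kappa$, $$\kappa\le\inf_{\mathrm{rank}(A)\le2r}\frac{\|\Sigma^{1/2}\mathrm{vec}(A)\|}{\|A\|_{\rm F}}\le\sup_{\mathrm{rank}(A)\le2r}\frac{\|\Sigma^{1/2}\mathrm{vec}(A)\|}{\|A\|_{\rm F}}\le\kappa_u,$$ where $A$ ranges over nonzero matrices in $\mathbb{R}^{p_1\times p_2}$. Let $\mathcal{A}(r,M,\sigma,\kappa)=\{A\in\mathbb{R}^{p_1\times p_2}:\mathrm{rank}(A)\le r,\ \|A\|_{\rm F}\le M\sigma/\kappa\}$, and for $A\in\mathcal{A}(r,M,\sigma,\kappa)$ let $P_A$ be the law of $(X,y)\in\mathbb{R}^{p_1\times p_2}\times\mathbb{R}$ with $\mathrm{vec}(X)\sim N(0,\Sigma)$ and $y\mid X\sim N(\mathrm{Tr}(X^TA),\sigma^2)$. For $\epsilon\in[0,1]$, let $(X_1,y_1),\dots,(X_n,y_n)$ be i.i.d. from $(1-\epsilon)P_A+\epsilon Q$, and let $\hat A$ be the pairwise-tournament estimator (defined in the context) over $\mathcal{A}(r,M,\sigma,\kappa)$ with $\delta\asymp\sqrt{\frac{r(p_1+p_2)}{n}}$. Assume $r(p_1+p_2)\le cn$ with some sufficiently small constant $c>0$. Then there are constants $C,C'>0$ such that $$\|\hat A-A\|_{\rm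 F}^2\le C\frac{\sigma^2}{\kappa^2}\left(\frac{r(p_1+p_2)}{n}\vee\epsilon^2\right)$$ with $\mathbb{P}_{(\epsilon,A,Q)}$-probability at least $1-\exp\left(-C'\left(r(p_1+p_2)+n\epsilon^2\right)\right)$, uniformly over $A\in\mathcal{A}(r,M,\sigma,\kappa)$ and all probability distributions $Q$.
   Context: $\|\cdot\|$ is the Euclidean norm, $\|\cdot\|_{\rm F}$ the Frobenius norm, $\mathrm{vec}$ the vectorization; $a\vee b=\max(a,b)$; $\mathsf{TV}$ is total variation distance. $\mathbb{P}_{(\epsilon,A,Q)}$ is the law under which the data are i.i.d. from $(1-\epsilon)P_A+\epsilon Q$. The relation $a\asymp b$ means $c_1b\le a\le c_2b$ for fixed constants $0<c_1\le c_2$. The constants $c,C,C'$ do not depend on $n,p_1,p_2,r,\sigma,\kappa,\Sigma,\epsilon,A,Q$ (they may depend on $M$ and the constants implicit in the relations $\asymp$). Tournament estimator over a parameter set $\mathcal{A}$ at scale $\delta$: let $\{A_1,\dots,A_m\}\subset\mathcal{A}$ be a $\delta$-covering set of minimal cardinality, i.e. $m$ is the smallest number such that for every $A\in\mathcal{A}$ there is $j$ with $\mathsf{TV}(P_{A_j},P_A)\le\delta$. Writing $Z_i=(X_i,y_i)$ and $p_A$ for the density of $P_A$ with respect to a common dominating measure, for $j\ne k$ put $B_{jk}=\{p_{A_j}>p_{A_k}\}$, $P_n(B)=\frac1n\sum_{i=1}^n\mathbb{I}\{Z_i\in B\}$ and $\phi_{jk}=\mathbb{I}\{|P_n(B_{jk})-P_{A_j}(B_{jk})|>|P_n(B_{jk})-P_{A_k}(B_{jk})|\}$.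 Then $\hat A=A_{\hat j}$ with $\hat j\in\arg\min_j\sum_{k\ne j}\phi_{jk}$ (any minimizer). *)

(* Defs.v *)
From HB Require Import structures.
From mathcomp Require Import all_boot all_order all_algebra.
From mathcomp Require Import all_classical all_reals all_analysis.
From mathcomp Require Import measurable_realfun.

Set Implicit Arguments.
Unset Strict Implicit.
Unset Printing Implicit Defensive.

Import Order.TTheory GRing.Theory Num.Theory.
Import numFieldNormedType.Exports.

Local Open Scope classical_set_scope.
Local Open Scope ring_scope.

(* The library norm on matrices is the sup norm, hence the two norms below. *)

Definition l2norm (R : realType) (k : nat) (v : 'cV[R]_k) : R :=
  Num.sqrt (\sum_i v i 0 ^+ 2).

Definition frobenius (R : realType) (p1 p2 : nat) (A : 'M[R]_(p1, p2)) : R :=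
  Num.sqrt (\sum_i \sum_j A i j ^+ 2).

(* mxvec enumerates the entries row by row. *)
Definition vec (R : realType) (p1 p2 : nat) (A : 'M[R]_(p1, p2)) :
  'cV[R]_(p1 * p2) := (mxvec A)^T.

Definition covariance_mx (R : realType) (k : nat) (S : 'M[R]_k) : Prop :=
  S^T = S /\ forall v : 'cV[R]_k, 0 <= (v^T *m S *m v) 0 0.

(* S^{1/2}, the unique positive semidefinite square root of a covariance
   matrix; 0 when S has no such root, i.e. is not a covariance matrix. *)
Definition sqrtmx (R : realType) (k : nat) (S : 'M[R]_k) : 'M[R]_k :=
  xget 0 [set T | covariance_mx T /\ T *m T = S].

Definition restricted_ratios (R : realType) (p1 p2 s : nat)
    (S : 'M[R]_(p1 * p2)) : set (\bar R) :=
  [set (l2norm (sqrtmx S *m vec A) / frobenius A)%:E |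
    A in [set A : 'M[R]_(p1, p2) | A != 0 /\ (\rank A <= s)%N]].

Definition param_set (R : realType) (p1 p2 r : nat) (M sigma kappa : R) :
    set 'M[R]_(p1, p2) :=
  [set A | (\rank A <= r)%N /\ frobenius A <= M * sigma / kappa].

(* The Borel sigma-algebra on matrices, generated by the entries. *)
Section measurable_matrix.
Context (R : realType) (p1 p2 : nat).

Definition mx_measurable : set (set 'M[R]_(p1, p2)) :=
  <<s \bigcup_(ij in [set: 'I_p1 * 'I_p2])
        preimage_set_system setT
          (fun A : 'M[R]_(p1, p2) => A ij.1 ij.2 : measurableTypeR R)
          measurable >>.

Let mx_measurable0 : mx_measurable set0.
Proof. exact: sigma_algebra0. Qed.

Let mx_measurableC A : mx_measurable A -> mx_measurable (~` A).
Proof. exact: sigma_algebraC. Qed.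

Let mx_measurable_bigcup (F : (set 'M[R]_(p1, p2))^nat) :
  (forall i, mx_measurable (F i)) -> mx_measurable (\bigcup_i (F i)).
Proof. exact: sigma_algebra_bigcup. Qed.

Definition mx_display : measure_display.
Proof. by constructor. Qed.

HB.instance Definition _ := @isMeasurable.Build mx_display
  'M[R]_(p1, p2) mx_measurable
  mx_measurable0 mx_measurableC mx_measurable_bigcup.

End measurable_matrix.

Lemma measurable_entry (R : realType) (p1 p2 : nat) (i : 'I_p1) (j : 'I_p2) :
  measurable_fun setT (fun A : 'M[R]_(p1, p2) => A i j : measurableTypeR R).
Proof.
move=> _ Y mY; rewrite setTI; apply: sub_sigma_algebra.
by exists (i, j) => //; exists Y => //; rewrite setTI.
Qed.

Notation obs R p1 p2 := ('M[R]_(p1, p2) * measurableTypeR R)%type.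

(* The centered normal law on R with variance v; the case v = 0 has to be
   separated because normal_prob 0 0 is not a point mass in the library. *)
Definition centered_normal (R : realType) (v : R) (B : set (measurableTypeR R)) :
    \bar R :=
  if v == 0 then \d_(0 : measurableTypeR R) B
  else normal_prob 0 (Num.sqrt v) B.

(* vec X ~ N(0, S), S possibly singular: every linear form u^T vec X is
   N(0, u^T S u). *)
Definition gaussian_mx (R : realType) (p1 p2 : nat) (S : 'M[R]_(p1 * p2))
    (PX : probability 'M[R]_(p1, p2) R) : Prop :=
  forall (u : 'cV[R]_(p1 * p2)) (B : set (measurableTypeR R)), measurable B ->
    PX [set X | B ((u^T *m vec X) 0 0)] =
    centered_normal ((u^T *m S *m u) 0 0) B.

(* The joint law of (X, y) with X ~ PX and y | X ~ N(Tr(X^T A), sigma^2). *)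
Section regression_law.
Context (R : realType) (p1 p2 : nat) (PX : probability 'M[R]_(p1, p2) R)
  (sigma : R) (A : 'M[R]_(p1, p2)).

Definition regression_law (B : set (obs R p1 p2)) : \bar R :=
  (\int[PX]_X normal_prob (\tr (X^T *m A)) sigma (xsection B X))%E.

Let measurable_mean :
  measurable_fun setT (fun X : 'M[R]_(p1, p2) =>
    \tr (X^T *m A) : measurableTypeR R).
Proof.
rewrite /mxtrace; apply: measurable_sum => i.
rewrite (_ : (fun _ => _) =
    fun X : 'M[R]_(p1, p2) => \sum_j X j i * A j i); last first.
  by apply/funext => X; rewrite mxE; apply: eq_bigr => j _; rewrite mxE.
apply: measurable_sum => j; apply: measurable_funM => //.
exact: measurable_entry.
Qed.

Let measurable_pdf :
  measurable_fun setT (fun z : obs R p1 p2 =>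
    (normal_pdf (\tr (z.1^T *m A)) sigma z.2)%:E).
Proof.
apply/measurable_EFinP; rewrite /normal_pdf; have [_|_] := eqVneq sigma 0.
  apply: (@measurableT_comp _ _ _ _ _ _ (\1_`[0, 1] : R -> R) _ snd) => //.
apply: measurable_funM => //; apply: measurableT_comp => //.
apply: measurable_funM => //; apply: measurableT_comp => //.
apply: measurable_funX; apply: measurable_funB => //.
exact: (measurableT_comp measurable_mean).
Qed.

Lemma measurable_regression_kernel (B : set (obs R p1 p2)) : measurable B ->
  measurable_fun setT (fun X =>
    normal_prob (\tr (X^T *m A)) sigma (xsection B X)).
Proof.
move=> mB.
pose f (z : obs R p1 p2) :=
  ((normal_pdf (\tr (z.1^T *m A)) sigma z.2)%:E * (\1_B z)%:E)%E.
rewrite (_ : (fun _ => _) =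
    fubini_F (lebesgue_measure : {measure set (measurableTypeR R) -> \bar R}) f).
  apply: measurable_fun_fubini_tonelli_F.
    apply: emeasurable_funM; first exact: measurable_pdf.
    by apply/measurable_EFinP; exact: measurable_indic.
  by move=> z; apply: mule_ge0; rewrite lee_fin// normal_pdf_ge0.
apply/funext => X; rewrite /fubini_F /normal_prob [LHS]integral_mkcond.
apply: eq_integral => y _; rewrite /f patchE /= indicE mem_xsection.
by case: ifPn => _; rewrite ?mule1 ?mule0.
Qed.

Let regression_law0 : regression_law set0 = 0%E.
Proof.
rewrite /regression_law (eq_integral (cst 0%E)) ?integral0// => X _.
by rewrite xsection0 measure0.
Qed.

Let regression_law_ge0 B : (0 <= regression_law B)%E.
Proof. by apply: integral_ge0 => X _; exact: measure_ge0. Qed.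

Let regression_law_sigma_additive : semi_sigma_additive regression_law.
Proof.
move=> F mF tF mUF; have mk := measurable_regression_kernel.
rewrite (_ : (fun n => _) = (fun n =>
    \int[PX]_X (\sum_(0 <= i < n)
       normal_prob (\tr (X^T *m A)) sigma (xsection (F i) X)))%E); last first.
  apply/funext => n; rewrite ge0_integral_sum//.
  by move=> i; exact: mk.
rewrite /regression_law (_ : (\int[PX]_X _ = \int[PX]_X
    (\sum_(0 <= i <oo)
       normal_prob (\tr (X^T *m A)) sigma (xsection (F i) X)))%E); last first.
  apply: eq_integral => X _; rewrite xsection_bigcup.
  rewrite measure_bigcup//.
  - by apply: eq_eseriesl => i; rewrite in_setT.
  - by move=> i _; exact: measurable_xsection.
  - exact: trivIset_xsection.
apply: cvg_monotone_convergence => //.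
- by move=> n; apply: emeasurable_sum => i; exact: mk.
- by move=> n X _; apply: sume_ge0 => i _; exact: measure_ge0.
- move=> X _ a b ab; apply: ereal_nondecreasing_series => // i _ _.
Qed.

HB.instance Definition _ := isMeasure.Build _ _ _ regression_law
  regression_law0 regression_law_ge0 regression_law_sigma_additive.

Let regression_law_setT : regression_law setT = 1%E.
Proof.
rewrite /regression_law (eq_integral (cst 1%E)) => [|X _].
  by rewrite integral_cst// mul1e; exact: probability_setT.
rewrite xsectionE preimage_setT.
exact: (@probability_setT _ _ _ (normal_prob (\tr (X^T *m A)) sigma)).
Qed.

HB.instance Definition _ := Measure_isProbability.Build _ _ _
  regression_law regression_law_setT.

End regression_law.

Definition tv (d : measure_display) (T : measurableType d) (R : realType)
    (P Q : probability T R) : R :=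
  sup [set `|fine (P B) - fine (Q B)| | B in measurable].

Definition is_density (d : measure_display) (T : measurableType d)
    (R : realType) (mu : {measure set T -> \bar R}) (P : probability T R)
    (f : T -> R) : Prop :=
  [/\ measurable_fun setT f, forall z, 0 <= f z &
      forall B, measurable B -> P B = (\int[mu]_(z in B) (f z)%:E)%E].

(* i.i.d. with common law (1 - eps) P + eps Q. *)
Definition huber_sample (d d' : measure_display) (Omega : measurableType d)
    (T : measurableType d') (R : realType) (Pr : probability Omega R)
    (n : nat) (Z : 'I_n -> {RV Pr >-> T}) (eps : R) (P Q : probability T R) :
    Prop :=
  (forall i B, measurable B ->
    distribution Pr (Z i) B = ((1 - eps)%:E * P B + eps%:E * Q B)%E) /\
  (forall (J : {set 'I_n}) (B : 'I_n -> set T), (forall i, measurable (B i)) ->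
    Pr (\bigcap_(i in [set` J]) (Z i @^-1` B i)) =
    (\prod_(i in J) Pr (Z i @^-1` B i))%E).

Section tournament.
Context (R : realType) (d : measure_display) (T : measurableType d)
  (Theta : Type) (P : Theta -> probability T R).

Definition is_cover (delta : R) (S : set Theta) (m : nat)
    (a : 'I_m -> Theta) : Prop :=
  (forall j, S (a j)) /\
  (forall t, S t -> exists j, tv (P (a j)) (P t) <= delta).

Definition is_minimal_cover (delta : R) (S : set Theta) (m : nat)
    (a : 'I_m -> Theta) : Prop :=
  is_cover delta S a /\
  forall (m' : nat) (a' : 'I_m' -> Theta), is_cover delta S a' -> (m <= m')%N.

Definition empirical (n : nat) (z : 'I_n -> T) (B : set T) : R :=
  (\sum_i \1_B (z i)) / n%:R.

(* p t is the density of P t. *)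
Variables (p : Theta -> T -> R) (m : nat) (a : 'I_m -> Theta).

Definition test_set (j k : 'I_m) : set T := [set z | p (a k) z < p (a j) z].

Definition phi (n : nat) (z : 'I_n -> T) (j k : 'I_m) : bool :=
  `|empirical z (test_set j k) - fine (P (a k) (test_set j k))| <
  `|empirical z (test_set j k) - fine (P (a j) (test_set j k))|.

Definition losses (n : nat) (z : 'I_n -> T) (j : 'I_m) : nat :=
  (\sum_(k | k != j) phi z j k)%N.

Definition tournament_winner (n : nat) (z : 'I_n -> T) (t : Theta) : Prop :=
  exists2 j : 'I_m, t = a j & forall k, (losses z j <= losses z k)%N.

End tournament.

Definition regression_model (R : realType) (p1 p2 : nat)
    (PX : probability 'M[R]_(p1, p2) R) (sigma : R) :
    'M[R]_(p1, p2) -> probability (obs R p1 p2) R :=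
  fun A => regression_law PX sigma A.

(* Main.v *)
Require Import Defs.
From HB Require Import structures.
From mathcomp Require Import all_boot all_order all_algebra.
From mathcomp Require Import all_classical all_reals all_analysis.
From mathcomp Require Import measurable_realfun ring lra zify.

Set Implicit Arguments.
Unset Strict Implicit.
Unset Printing Implicit Defensive.

Import Order.TTheory GRing.Theory Num.Theory.
Import numFieldNormedType.Exports.

Local Open Scope classical_set_scope.
Local Open Scope ring_scope.

(** The tournament is analysed in total variation and the conclusion is then
    translated into Frobenius norm.

    Translation. Put [tau = |Sigma^{1/2} vec (A - B)|]. Given [X], the laws of
    [y] under [A] and [B] are normal with variance [sigma ^ 2] and means that
    differ by an [N(0, tau ^ 2)] variable, so the total variation distance
    between [P_A] and [P_B] is of order [tau / sigma] as long as this ratio is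
    bounded ([regression_tv_bounds]). The restricted eigenvalue condition and
    the bound on the Frobenius norms over the parameter set turn this into
    [regression_model_tv]: total variation is equivalent to
    [(kappa / sigma) * frobenius (A - B)].

    Tournament. Let [d j] be the distance from the truth to the cover point
    [a j], and [rho] a large multiple of [delta + eps]. If no match between a
    point with [d g <= rho] and a point with [rho < d j] is distorted by more
    than a fraction of [d j], then every point of the ball of radius [rho] beats
    every point beyond [5 * rho], while the cover point nearest to the truth
    only loses inside the ball. Counting losses, the winner is within [5 * rho]
    of the truth ([winner_near]).

    Probability of distortion. The contamination moves each probability by at
    most [eps], which is part of [rho]; the rest is a Chernoff bound
    [exp (- c * n * d j ^ 2)] per match ([chernoff_two_sided]). The union bound
    runs over the ball and over shells [l * delta <= d j < (l + 1) * delta], and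
    [n * delta ^ 2] is of order [r * (p1 + p2)], so it suffices that the ball of
    radius [l * delta] contains at most [exp (C0 * r * (p1 + p2) * l)] cover
    points ([ball_times_far_sum], [tournament_risk]). Using this local count
    rather than the cardinality of the whole cover is what avoids a logarithmic
    factor.

    Local count. In a minimal cover, the points of a ball can be exchanged for a
    maximal separated set of a slightly larger ball ([minimal_cover_local]), so
    their number is a packing number of matrices of rank at most [2 * r]. Such a
    matrix factors as [U V] with [U] nonexpansive and [V] of the same Frobenius
    norm at most ([low_rank_factor]); the pairs [(U, V)] live in a normed space
    of dimension [2 * r * (p1 + p2)], where packing numbers are exponential in
    the dimension ([lattice_packing]). *)

(** * Concentration of empirical frequencies *)

(** Obtained by inverting [expR (- x) >= 1 - x]. *)
Lemma expR_le_quadratic (R : realType) (x : R) :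
  x <= 2^-1 -> expR x <= 1 + x + 2 * x ^+ 2.
Proof.
move=> x2; have h := expR_ge1Dx (- x).
have e0 : 0 < expR x by exact: expR_gt0.
have : expR x * (1 - x) <= 1.
  by rewrite -[leRHS]expR0 -(subrr x) expRD (ler_pM2l e0).
move=> h1; have x1 : 0 < 1 - x by lra.
rewrite -(ler_pM2r x1).
have x3 : 0 <= 1 - 2 * x by lra.
by have := mulr_ge0 (sqr_ge0 x) x3; lra.
Qed.

(** Hoeffding's lemma for a Bernoulli variable, with a worse constant. *)
Lemma bernoulli_mgf (R : realType) (q x : R) : 0 <= q <= 1 -> x <= 2^-1 ->
  1 - q + q * expR x <= expR (q * x + 2 * x ^+ 2).
Proof.
move=> /andP[q0 q1] x2; apply: le_trans (expR_ge1Dx _).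
have h := ler_wpM2l q0 (expR_le_quadratic x2).
have := ler_wpM2r (sqr_ge0 x) q1; lra.
Qed.

Lemma prodr_pattern (R : realType) (n : nat) (a b : R) (J : {set 'I_n}) :
  \prod_(i < n) (if i \in J then a else b) = a ^+ #|J| * b ^+ #|~: J|.
Proof.
rewrite (bigID [in J]) /=; congr (_ * _).
  by rewrite (eq_bigr (fun=> a)) ?prodr_const// => i ->.
rewrite (eq_bigl [in ~: J]); last by move=> i; rewrite inE.
rewrite (eq_bigr (fun=> b)) ?prodr_const// => i.
by rewrite inE => /negbTE ->.
Qed.

Lemma sum_subsets_bernoulli (R : realType) (n : nat) (a b : R) :
  \sum_(J : {set 'I_n}) a ^+ #|J| * b ^+ #|~: J| = (a + b) ^+ n.
Proof.
rewrite -[RHS](_ : \prod_(i < n) (a + b) = _); last by rewrite prodr_const card_ord.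
pose f (J : {set 'I_n}) : {ffun 'I_n -> bool} := [ffun i => i \in J].
have -> : \prod_(i < n) (a + b) =
    \prod_(i < n) \sum_(c : bool) (if c then a else b).
  by apply: eq_bigr => i _; rewrite big_bool.
rewrite bigA_distr_bigA /= (reindex f) /=.
  by apply: eq_bigr => J _; rewrite -prodr_pattern; apply: eq_bigr => i _; rewrite ffunE.
exists (fun g : {ffun 'I_n -> bool} => [set i | g i]%SET).
  by move=> J _; apply/setP => i; rewrite !inE ffunE.
by move=> g _; apply/ffunP => i; rewrite ffunE inE.
Qed.

Section finite_union_bound.
Context (d : measure_display) (T : measurableType d) (R : realType)
  (mu : {measure set T -> \bar R}).

Lemma measure_le_sum (I : finType) (P : pred I) (F : I -> set T) (A : set T) :
  measurable A -> (forall i, P i -> measurable (F i)) ->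
  (forall w, A w -> exists2 i, P i & F i w) ->
  (mu A <= \sum_(i | P i) mu (F i))%E.
Proof.
move=> mA mF AF.
have sub : A `<=` \big[setU/set0]_(i | P i) F i.
  move=> w /AF[i Pi Fi]; rewrite -(bigcup_pred P F).
  by exists i.
have mU : measurable (\big[setU/set0]_(i | P i) F i).
  by apply: bigsetU_measurable => i; exact: mF.
apply: (le_trans (le_measure mu _ _ sub)); rewrite ?inE//.
have [//] : measurable (\big[setU/set0]_(i | P i) F i) /\
    (mu (\big[setU/set0]_(i | P i) F i) <= \sum_(i | P i) mu (F i))%E.
elim/big_ind2 : _ => [|x1 x2 y1 y2 [mx hx] [my hy]|i Pi].
- by split; [exact: measurable0 | rewrite measure0].
- split; first exact: measurableU.
  by apply: (le_trans (measureU2 _ mx my)); exact: leeD.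
- by split; [exact: mF|].
Qed.

End finite_union_bound.

Section chernoff.
Context (R : realType) (d d' : measure_display) (Omega : measurableType d)
  (T : measurableType d') (Pr : probability Omega R) (n : nat)
  (Z : 'I_n -> {RV Pr >-> T}) (B : set T) (q : R).
Hypotheses (mB : measurable B) (q01 : 0 <= q <= 1).
Hypothesis ZB : forall i, Pr (Z i @^-1` B) = q%:E.
Hypothesis indep : forall F : 'I_n -> set T, (forall i, measurable (F i)) ->
  Pr (\bigcap_i (Z i @^-1` F i)) = (\prod_i Pr (Z i @^-1` F i))%E.

(** The empirical frequency of [B] only depends on the random set of indices
    that hit [B], whose law is explicit: tail probabilities are finite sums over
    subsets of ['I_n]. *)
Let hits w := [set i | `[< B (Z i w) >]]%SET.

Let hitsE J : [set w | hits w = J] =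
  \bigcap_i (Z i @^-1` (if i \in J then B else ~` B)).
Proof.
apply/seteqP; split => w /=.
  by move=> <- i _; rewrite /= inE; case: ifPn => /asboolP.
move=> h; apply/setP => i; rewrite inE; have := h i I; rewrite /=.
by case: ifPn => _ ?; [apply/asboolP|apply/asboolPn].
Qed.

Let measurable_hits J : measurable [set w | hits w = J].
Proof.
rewrite hitsE; apply: fin_bigcap_measurable => //= i _.
apply: measurable_funPTI.
by case: ifPn => _ //; exact: measurableC.
Qed.

Let Pr_hits J : Pr [set w | hits w = J] = (q ^+ #|J| * (1 - q) ^+ #|~: J|)%:E.
Proof.
rewrite hitsE indep; last by move=> i; case: ifPn => _ //; exact: measurableC.
rewrite (eq_bigr (fun i => (if i \in J then q else 1 - q)%:E)) => [|i _].
  by rewrite prodEFin prodr_pattern.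
case: ifPn => // _; rewrite preimage_setC probability_setC ?ZB//.
exact: measurable_funPTI.
Qed.

Lemma empirical_hits w : empirical R (fun i => Z i w) B = #|hits w|%:R / n%:R.
Proof.
rewrite /empirical -sum1_card natr_sum [in RHS]big_mkcond; congr (_ / _).
apply: eq_bigr => i _; rewrite indicE inE.
by case: ifPn => /asboolP h; [rewrite mem_set|rewrite memNset].
Qed.

Lemma measurable_empirical_preimage (D : set R) :
  measurable [set w | D (empirical R (fun i => Z i w) B)].
Proof.
rewrite (_ : [set w | _] =
    \bigcup_(J in [set J : {set 'I_n} | D (#|J|%:R / n%:R)]) [set w | hits w = J]).
  by apply: fin_bigcup_measurable.
apply/seteqP; split => w /=; rewrite empirical_hits.
  by move=> h; exists (hits w).
by move=> [J] DJ ->.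
Qed.

(** Either sign of [x] is allowed, which gives both tails. *)
Lemma chernoff_one_sided (x t : R) : (0 < n)%N -> x <= 2^-1 ->
  (Pr [set w | (t < x * (empirical R (fun i => Z i w) B - q))%R] <=
   (expR (n%:R * (2 * x ^+ 2 - t)))%:E)%E.
Proof.
move=> n0 x2.
pose bad (J : {set 'I_n}) := t < x * (#|J|%:R / n%:R - q).
apply: (le_trans (measure_le_sum Pr (P := bad)
  (F := fun J => [set w | hits w = J]) _ _ _)) => //.
  by apply: (measurable_empirical_preimage [set y | t < x * (y - q)]).
  by move=> w /=; rewrite empirical_hits => h; exists (hits w).
rewrite (eq_bigr _ (fun J _ => Pr_hits J)) sumEFin lee_fin.
have n0R : (0 : R) < n%:R by rewrite ltr0n.
have q1 : 0 <= 1 - q by rewrite subr_ge0; case/andP: q01.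
have q0 : 0 <= q by case/andP: q01.
apply: (@le_trans _ _ (\sum_(J : {set 'I_n}) expR (- (n%:R * (t + x * q))) *
    ((q * expR x) ^+ #|J| * (1 - q) ^+ #|~: J|))).
  rewrite [leLHS]big_mkcond; apply: ler_sum => J _; case: ifPn => [bJ|_].
    rewrite exprMn; set u := q ^+ _; set v := _ ^+ #|~: J|.
    set e := expR _; set f := expR x ^+ _.
    have -> : e * (u * f * v) = u * v * (e * f) by ring.
    rewrite ler_peMr//.
      by rewrite mulr_ge0 ?exprn_ge0.
    rewrite /e /f -expRM_natl -expRD -[leLHS]expR0 ler_expR.
    move: bJ; rewrite /bad -(ltr_pM2l n0R) mulrBr.
    have -> : n%:R * (x * (#|J|%:R / n%:R) - x * q) =
       #|J|%:R * x - n%:R * (x * q) by field; rewrite gt_eqF.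
    lra.
  by rewrite mulr_ge0 ?expR_ge0// mulr_ge0 ?exprn_ge0// mulr_ge0 ?expR_ge0.
rewrite -mulr_sumr sum_subsets_bernoulli.
apply: (@le_trans _ _ (expR (- (n%:R * (t + x * q))) *
    expR (q * x + 2 * x ^+ 2) ^+ n)).
  rewrite ler_wpM2l ?expR_ge0// lerXn2r ?nnegrE ?expR_ge0//.
    by rewrite addr_ge0// mulr_ge0// expR_ge0.
  by rewrite addrC bernoulli_mgf.
rewrite -expRM_natl -expRD ler_expR; lra.
Qed.

(** With [x = s / 4] or [x = - s / 4], which balances the linear gain
    [n * |x| * s] against the quadratic loss [2 * n * x ^ 2]. *)
Lemma chernoff_two_sided (s : R) : (0 < n)%N -> 0 < s <= 1 ->
  (Pr [set w | (s < `|empirical R (fun i => Z i w) B - q|)%R] <=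
   (2 * expR (- (n%:R * (s ^+ 2 / 8))))%:E)%E.
Proof.
move=> n0 /andP[s0 s1].
have mE x t := measurable_empirical_preimage [set y | t < x * (y - q)].
have mA := measurable_empirical_preimage [set y | s < `|y - q|].
pose F (b : bool) := [set w | s ^+ 2 / 4 < (-1) ^+ b * (s / 4) *
  (empirical R (fun i => Z i w) B - q)].
have sub : [set w | s < `|empirical R (fun i => Z i w) B - q|] `<=`
    F false `|` F true.
  move=> w /=; rewrite /F /=; case: ger0P => _ h; [left|right] => /=;
    rewrite ?expr0 ?expr1; have := mulr_gt0 s0 s0; nra.
apply: (le_trans (le_measure Pr _ _ sub)); rewrite ?inE //.
  by apply: measurableU; exact: mE.
apply: (le_trans (measureU2 _ (mE _ _) (mE _ _))).
rewrite mulr_natl mulr2n EFinD; apply: leeD.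
  apply: (le_trans (chernoff_one_sided _ n0 _)); first by rewrite /=; lra.
  by rewrite lee_fin ler_expR /=; lra.
apply: (le_trans (chernoff_one_sided _ n0 _)); first by rewrite /=; lra.
by rewrite lee_fin ler_expR /=; lra.
Qed.
End chernoff.

(** * Total variation and densities *)

Section total_variation.
Context (d : measure_display) (T : measurableType d) (R : realType).
Implicit Types P Q S : probability T R.

Let fin P B : measurable B -> P B \is a fin_num.
Proof. by move=> mB; exact: fin_num_measure. Qed.

Lemma fine_prob01 P B : measurable B -> 0 <= fine (P B) <= 1.
Proof.
move=> mB; rewrite fine_ge0 ?measure_ge0//=.
by rewrite -lee_fin fineK ?fin// probability_le1.
Qed.

Let tv_ubound P Q :
  has_ubound [set `|fine (P B) - fine (Q B)| | B in measurable].
Proof.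
exists 1 => _ [B mB <-].
have /andP[? ?] := fine_prob01 P mB; have /andP[? ?] := fine_prob01 Q mB.
by rewrite ler_norml; apply/andP; split; lra.
Qed.

Lemma tv_ge P Q B : measurable B -> `|fine (P B) - fine (Q B)| <= tv P Q.
Proof. by move=> mB; apply: ub_le_sup => //; exists B. Qed.

Lemma tv_le P Q x :
  (forall B, measurable B -> `|fine (P B) - fine (Q B)| <= x) -> tv P Q <= x.
Proof.
move=> h; apply: ge_sup; last by move=> _ [B mB <-]; exact: h.
by exists `|fine (P set0) - fine (Q set0)|; exists set0.
Qed.

Lemma tv_ge0 P Q : 0 <= tv P Q.
Proof. exact: le_trans (normr_ge0 _) (tv_ge P Q measurable0). Qed.

Lemma tv_le1 P Q : tv P Q <= 1.
Proof.
apply: tv_le => B mB.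
have /andP[? ?] := fine_prob01 P mB; have /andP[? ?] := fine_prob01 Q mB.
by rewrite ler_norml; apply/andP; split; lra.
Qed.

Lemma tv_sym P Q : tv P Q = tv Q P.
Proof.
by apply/le_anti/andP; split; apply: tv_le => B mB; rewrite distrC; exact: tv_ge.
Qed.

Lemma tv_triangle P Q S : tv P S <= tv P Q + tv Q S.
Proof.
apply: tv_le => B mB; apply: le_trans (lerD (tv_ge P Q mB) (tv_ge Q S mB)).
exact: ler_distD.
Qed.

Lemma tv_id P : tv P P = 0.
Proof.
apply/le_anti/andP; split; last exact: tv_ge0.
by apply: tv_le => B _; rewrite subrr normr0.
Qed.

(** Scheffe's identity: the set where one density exceeds the other attains
    the total variation distance, because passing from [B] to that set only
    adds points of positive excess and removes points of nonpositive one. *)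
Lemma scheffe (mu : {measure set T -> \bar R}) P Q (f g : T -> R) :
  is_density mu P f -> is_density mu Q g ->
  measurable [set z | g z < f z] /\
  tv P Q = fine (P [set z | g z < f z]) - fine (Q [set z | g z < f z]).
Proof.
move=> [mf f0 Pf] [mg g0 Qg]; set D := [set z | _].
have mD : measurable D.
  have /(_ measurableT) := measurable_fun_ltr mg mf.
  move=> /(_ [set true] ltac:(by [])); rewrite setTI.
  by congr measurable; apply/seteqP; split => z.
have mono (P1 P2 : probability T R) (f1 f2 : T -> R) B :
    measurable B -> is_density mu P1 f1 -> is_density mu P2 f2 ->
    (forall z, B z -> f1 z <= f2 z) -> fine (P1 B) <= fine (P2 B).
  move=> mB [mf1 f10 P1f] [mf2 f20 P2f] h.
  rewrite fine_le ?fin// P1f// P2f//; apply: ge0_le_integral => //.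
  - by move=> z _; rewrite lee_fin.
  - by apply/measurable_EFinP; exact: measurable_funTS.
  - by apply/measurable_EFinP; exact: measurable_funTS.
have split (P1 : probability T R) B C : measurable B -> measurable C ->
    fine (P1 B) = fine (P1 (B `&` C)) + fine (P1 (B `\` C)).
  move=> mB mC; rewrite -fineD ?fin//; [|exact: measurableI|exact: measurableD].
  by rewrite addeC -measureDI.
have dP : is_density mu P f by split.
have dQ : is_density mu Q g by split.
have key B : measurable B -> fine (P B) - fine (Q B) <= fine (P D) - fine (Q D).
  move=> mB; rewrite (split P B D)// (split Q B D)// (split P D B)// (split Q D B)//.
  rewrite !(setIC D B).
  have := mono P Q f g (B `\` D) (measurableD mB mD) dP dQ
    (fun z h => ltac:(by rewrite leNgt; apply/negP; exact: h.2)).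
  have := mono Q P g f (D `\` B) (measurableD mD mB) dQ dP
    (fun z h => ltac:(by apply: ltW; exact: h.1)).
  lra.
split=> //; apply/le_anti/andP; split; last first.
  exact: le_trans (ler_norm _) (tv_ge P Q mD).
apply: tv_le => B mB; rewrite ler_norml lerNl opprB key// andbT.
have := key _ (measurableC mB); rewrite !probability_setC//.
rewrite !fineB ?fin//= => h; lra.
Qed.

End total_variation.

(** * Sums over shells *)

Lemma sum_half_le2 (R : realType) (N : nat) :
  \sum_(l < N) (2^-1 : R) ^+ l <= 2.
Proof.
suff -> : \sum_(l < N) (2^-1 : R) ^+ l = 2 - 2 * 2^-1 ^+ N.
  by rewrite gerBl mulr_ge0// exprn_ge0// invr_ge0.
elim: N => [|N IH]; first by rewrite big_ord0 expr0 mulr1 subrr.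
rewrite big_ord_recr /= IH exprS; lra.
Qed.

Lemma expR_ge_pow2 (R : realType) (l : nat) : 2 ^+ l <= expR l%:R :> R.
Proof.
rewrite -[l%:R]mulr1 expRM_natl lerXn2r ?nnegrE ?expR_ge0//.
by have := expR_ge1Dx (1 : R); lra.
Qed.

(** Points at distance [y] number at most [exp (kap * v * y)] and weigh
    [exp (- c * v * y ^ 2)]; beyond a large multiple of [kap / c] the quadratic
    term wins. *)
Lemma shell_sum (R : realType) (I : finType) (y : I -> R) (v kap c rho : R) :
  0 < c -> 0 <= kap -> 0 < v -> (forall i, 0 <= y i) -> 2 <= rho ->
  8 * kap <= c * rho -> 8 <= c * v * rho ->
  (forall l : nat, (0 < l)%N ->
     #|[pred i | y i <= l%:R]|%:R <= expR (kap * v * l%:R)) ->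
  \sum_(i | rho < y i) expR (- (c * v * y i ^+ 2)) <=
    2 * expR (- (c / 16 * v * rho ^+ 2)).
Proof.
move=> c0 k0 v0 y0 rho2 hk hv hcount.
pose s i := Num.truncn (y i).
pose N := (\max_i s i).+1.
have sN i : (s i < N)%N by rewrite ltnS; exact: leq_bigmax.
have itv i : (s i)%:R <= y i < (s i).+1%:R by apply: truncn_itv.
have cv0 : 0 < c * v by exact: mulr_gt0.
pose term (l : nat) := expR (- (c * v * l%:R ^+ 2)).
apply: (@le_trans _ _ (\sum_(i | rho < y i) \sum_(l < N)
    (if s i == l then term l else 0))).
  apply: ler_sum => i _; rewrite (bigD1 (Ordinal (sN i))) //= eqxx.
  rewrite big1 ?addr0 => [|l]; last first.
    by rewrite -val_eqE /= eq_sym => /negbTE ->.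
  rewrite ler_expR lerN2 ler_pM2l// lerXn2r ?nnegrE//.
  by case/andP: (itv i).
rewrite exchange_big /=.
apply: (@le_trans _ _ (\sum_(l < N) expR (- (c / 16 * v * rho ^+ 2)) * 2^-1 ^+ l)).
  apply: ler_sum => l _; rewrite -big_mkcondr /= sumr_const.
  have [hl|hl] := ltP (rho / 2) l%:R; last first.
    rewrite eq_card0 ?mulr0n ?mulr_ge0 ?expR_ge0 ?exprn_ge0 ?invr_ge0// => i.
    rewrite inE; apply/negbTE/negP => /andP[h1 /eqP h2].
    have /andP[_] := itv i; rewrite h2 -natr1; lra.
  have hc : #|[pred i | (rho < y i) && (s i == l)]|%:R <=
      expR (kap * v * l.+1%:R).
    apply: le_trans (hcount _ _) => //; rewrite ler_nat; apply: subset_leq_card.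
    apply/fintype.subsetP => i; rewrite !inE => /andP[_ /eqP <-].
    by apply: ltW; case/andP: (itv i).
  rewrite -(mulr_natl (term l)); apply: (le_trans (ler_wpM2r (expR_ge0 _) hc)).
  rewrite -expRD exprVn.
  have h2 := expR_ge_pow2 R l.
  apply: (@le_trans _ _ (expR (- (c / 16 * v * rho ^+ 2)) * expR (- l%:R))); last first.
    by rewrite ler_wpM2l ?expR_ge0// expRN lef_pV2 ?posrE ?expR_gt0 ?exprn_gt0.
  rewrite -expRD ler_expR -natr1.
  set L : R := l%:R in hl *.
  (* half of the quadratic decay pays for the shell count, a quarter for the
     geometric factor [2 ^- l], and a quarter is kept *)
  have e1 : kap * v * (L + 1) <= c * v * L ^+ 2 / 2.
    have a1 : 0 <= v * L * (c * L / 2 - 2 * kap) by rewrite !mulr_ge0//; nra.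
    have a2 : 0 <= kap * v * (L - 1) by rewrite !mulr_ge0//; lra.
    nra.
  have e2 : L <= c * v * L ^+ 2 / 4.
    have a1 : 0 <= L * (c * v * L / 4 - 1) by rewrite !mulr_ge0//; nra.
    nra.
  have e3 : c / 16 * v * rho ^+ 2 <= c * v * L ^+ 2 / 4.
    have a1 : 0 <= c * v * ((L - rho / 2) * (L + rho / 2)).
      by rewrite !mulr_ge0//; lra.
    nra.
  lra.
by rewrite -mulr_sumr mulrC ler_wpM2r ?expR_ge0 ?sum_half_le2.
Qed.

(** The two counts of the union bound, over the ball of radius [rho] and over
    its complement: the number of pairs they make is absorbed by the decay. *)
Lemma ball_times_far_sum (R : realType) (I : finType) (y : I -> R)
    (v kap c rho : R) :
  0 < c -> 0 <= kap -> 0 < v -> (forall i, 0 <= y i) -> 2 <= rho ->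
  64 * kap <= c * rho -> 8 <= c * v * rho ->
  (forall l : nat, (0 < l)%N ->
     #|[pred i | y i <= l%:R]|%:R <= expR (kap * v * l%:R)) ->
  #|[pred i | y i <= rho]|%:R * \sum_(i | rho < y i) expR (- (c * v * y i ^+ 2)) <=
    2 * expR (- (c / 32 * v * rho ^+ 2)).
Proof.
move=> c0 k0 v0 y0 rho2 hk hv hcount.
have far := shell_sum c0 k0 v0 y0 rho2 (_ : 8 * kap <= c * rho) hv hcount.
have {}far := far ltac:(lra).
have ball : #|[pred i | y i <= rho]|%:R <= expR (c / 32 * v * rho ^+ 2).
  pose l := (Num.truncn rho).+1.
  have /andP[l1 l2] : (Num.truncn rho)%:R <= rho < l%:R by apply: truncn_itv; lra.
  have lr : l%:R <= 2 * rho by rewrite /l -natr1; lra.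
  apply: (@le_trans _ _ #|[pred i | y i <= l%:R]|%:R).
    rewrite ler_nat; apply: subset_leq_card; apply/fintype.subsetP => i.
    by rewrite !inE => /le_trans; apply; exact: ltW.
  apply: (le_trans (hcount l _)) => //; rewrite ler_expR.
  apply: (@le_trans _ _ (kap * v * (2 * rho))).
    by rewrite ler_wpM2l// mulr_ge0// ltW.
  have vr0 : 0 <= v * rho by rewrite mulr_ge0//; lra.
  by have := ler_wpM2r vr0 hk; rewrite expr2; lra.
have -> : - (c / 32 * v * rho ^+ 2) =
    c / 32 * v * rho ^+ 2 + - (c / 16 * v * rho ^+ 2) by field.
rewrite expRD [leRHS]mulrCA; apply: ler_pM => //.
by apply: sumr_ge0 => i _; exact: expR_ge0.
Qed.

(** The prefactor [8] costs half of the exponent, which is at least [6] because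
    [n * delta ^ 2 >= dd] and [k] is large; the other half has the announced form because
    [(delta + eps) ^ 2 >= delta ^ 2 + eps ^ 2]. *)
Lemma tournament_exponent (R : realType) (c k dd n D delta eps : R) :
  0 < c -> 4 <= k -> 0 < dd -> 192 <= c * dd * k -> 1 <= D -> 0 < n ->
  0 <= delta -> 0 <= eps -> dd * D <= n * delta ^+ 2 ->
  8 * expR (- (c / 32 * (n * (k * (delta + eps)) ^+ 2))) <=
    expR (- (c / 64 * k ^+ 2 * Num.min 1 dd * (D + n * eps ^+ 2))).
Proof.
move=> c0 k4 dd0 ck D1 n0 delta0 eps0 hD.
have cross0 : 0 <= n * delta * eps by rewrite !mulr_ge0// ltW.
have w0 : 0 <= n * eps ^+ 2 by rewrite mulr_ge0 ?sqr_ge0// ltW.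
have -> : n * (k * (delta + eps)) ^+ 2 =
  k ^+ 2 * (n * delta ^+ 2 + n * eps ^+ 2 + 2 * (n * delta * eps)) by ring.
move: (n * delta ^+ 2) (n * eps ^+ 2) (n * delta * eps) hD w0 cross0 => v w x hD w0 x0.
have D0 : 0 <= D by lra.
have k0 : 0 <= k by lra.
have v_ge : dd <= v by apply: le_trans hD; rewrite ler_peMr// ltW.
set X := k ^+ 2 * _.
have X3 : 3 <= c / 64 * X.
  have h : dd * k <= X.
    rewrite /X mulrC expr2 -mulrA ler_wpM2l//.
    by apply: (@le_trans _ _ (1 * dd)); [lra|apply: ler_pM => //; [exact: ltW|lra|lra]].
  by have := ler_wpM2l (ltW c0) h; lra.
have rate : c / 64 * k ^+ 2 * Num.min 1 dd * (D + w) <= c / 64 * X.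
  rewrite /X -!mulrA !ler_wpM2l ?sqr_ge0 ?invr_ge0 ?(ltW c0)//.
  have m1 : Num.min 1 dd <= 1 by rewrite ge_min lexx.
  have m2 : Num.min 1 dd <= dd by rewrite ge_min lexx orbT.
  by have := ler_wpM2r D0 m2; have := ler_wpM2r w0 m1; rewrite mulrDr; lra.
apply: (@le_trans _ _ (expR (c / 64 * X) * expR (- (c / 32 * X)))).
  rewrite ler_wpM2r ?expR_ge0//.
  apply: le_trans (_ : expR 3%:R <= _); last by rewrite ler_expR.
  by apply: le_trans (expR_ge_pow2 R 3); rewrite -natrX ler_nat.
by rewrite -expRD ler_expR; lra.
Qed.

(** * The tournament *)

Section tournament_analysis.
Context (R : realType) (d : measure_display) (T : measurableType d)
  (Theta : Type) (P : Theta -> probability T R) (p : Theta -> T -> R)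
  (mu : {measure set T -> \bar R}) (m : nat) (a : 'I_m -> Theta) (t : Theta).
Hypothesis dens : forall j, is_density mu (P (a j)) (p (a j)).

Let dist j := tv (P t) (P (a j)).

Lemma measurable_test_set j k : measurable (test_set p a j k).
Proof. by have [] := scheffe (dens j) (dens k). Qed.

Lemma tv_test_set j k : tv (P (a j)) (P (a k)) =
  fine (P (a j) (test_set p a j k)) - fine (P (a k) (test_set p a j k)).
Proof. by have [] := scheffe (dens j) (dens k). Qed.

(** Everything in the ball of radius [rho] around the truth beats everything
    at distance more than [5 * rho], so a far winner would lose at least as
    many matches as there are cover points in that ball; a nearest cover point
    only loses inside the ball, hence strictly fewer. *)
Lemma winner_near (n : nat) (z : 'I_n -> T) (q : set T -> R) (delta eps rho : R)
    (js : 'I_m) (u : Theta) :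
  0 <= delta -> 0 <= eps -> 4 * (delta + eps) <= rho -> 0 < rho ->
  dist js <= delta ->
  (forall B, measurable B -> `|q B - fine (P t B)| <= eps) ->
  (forall g j, dist g <= rho -> rho < dist j ->
    `|empirical R z (test_set p a g j) - q (test_set p a g j)| <= dist j / 8 /\
    `|empirical R z (test_set p a j g) - q (test_set p a j g)| <= dist j / 8) ->
  tournament_winner P p a z u -> tv (P t) (P u) <= 5 * rho.
Proof.
move=> delta0 eps0 hrho rho0 hjs hq good [j -> win].
rewrite leNgt; apply/negP; rewrite -/(dist j) => far.
pose G := [pred k | dist k <= rho].
have jsG : js \in G by rewrite inE; lra.
have jNG : j \notin G by rewrite inE -ltNge; lra.
(* in a match (j, k) the empirical measure of the test set is close to the
   probability under whichever of the two is close to the truth *)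
have near_first g k x (B := test_set p a g k) : dist g <= x ->
    `|empirical R z B - q B| <= dist k / 8 ->
    `|empirical R z B - fine (P (a g) B)| <= dist k / 8 + eps + x.
  move=> gx h; have mB := measurable_test_set g k.
  have h1 := hq B mB; have h2 := tv_ge (P t) (P (a g)) mB.
  apply: (le_trans (ler_distD (q B) _ _)); rewrite -addrA lerD//.
  apply: (le_trans (ler_distD (fine (P t B)) _ _)); rewrite lerD//.
  exact: le_trans h2 gx.
have near_second g k x (B := test_set p a k g) : dist g <= x ->
    `|empirical R z B - q B| <= dist k / 8 ->
    `|empirical R z B - fine (P (a g) B)| <= dist k / 8 + eps + x.
  move=> gx h; have mB := measurable_test_set k g.
  have h1 := hq B mB; have h2 := tv_ge (P t) (P (a g)) mB.
  apply: (le_trans (ler_distD (q B) _ _)); rewrite -addrA lerD//.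
  apply: (le_trans (ler_distD (fine (P t B)) _ _)); rewrite lerD//.
  exact: le_trans h2 gx.
have js_beats k : k \notin G -> phi P p a z js k = false.
  rewrite inE -ltNge => kfar; apply/negbTE; rewrite -leNgt.
  have [h _] := good js k ltac:(lra) kfar.
  have h1 := near_first js k delta hjs h.
  have hT := tv_test_set js k.
  have tri := tv_triangle (P t) (P (a js)) (P (a k)).
  rewrite -/(dist k) -/(dist js) in tri.
  move: h1 hT; set B := test_set _ _ _ _; set e := empirical _ _ _.
  set pj := fine _; set pk := fine _ => h1 hT.
  apply: (le_trans h1).
  have h2 : pj - pk <= `|e - pj| + `|e - pk|.
    apply: (le_trans (ler_norm _)); rewrite addrC (distrC e pj).
    by rewrite addrC; exact: ler_distD.
  lra.
have G_beats k : k \in G -> phi P p a z j k.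
  rewrite inE => kG; have jfar : rho < dist j by lra.
  have [_ h] := good k j kG jfar.
  have h1 := near_second k j rho kG h.
  have hT := tv_test_set j k.
  have tri := tv_triangle (P t) (P (a k)) (P (a j)).
  rewrite -/(dist k) -/(dist j) (tv_sym (P (a k))) in tri.
  rewrite /phi; move: h1 hT; set B := test_set _ _ _ _; set e := empirical _ _ _.
  set pk := fine _; set pj := fine _ => h1 hT.
  apply: (le_lt_trans h1).
  have h2 : pj - pk <= `|e - pj| + `|e - pk|.
    apply: (le_trans (ler_norm _)); rewrite addrC (distrC e pj).
    by rewrite addrC; exact: ler_distD.
  lra.
have lj : (#|G| <= losses P p a z j)%N.
  rewrite /losses -sum1_card [leqRHS](bigID [in G]) /=.
  apply: leq_trans (leq_addr _ _).
  rewrite [leqLHS](eq_bigl (fun k => (k != j) && (k \in G))); last first.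
    by move=> k; have [->|//] := eqVneq; rewrite (negbTE jNG).
  by apply: leq_sum => k /andP[_ /G_beats ->].
have ljs : (losses P p a z js < #|G|)%N.
  rewrite (cardD1 js) jsG add1n ltnS /losses -sum1_card.
  rewrite [leqLHS](bigID [in G]) /= [X in (_ + X <= _)%N]big1 ?addn0; last first.
    by move=> k /andP[_ /js_beats ->].
  rewrite [leqRHS](eq_bigl (fun k => (k != js) && (k \in G))); last first.
    by move=> k; rewrite !inE.
  by apply: leq_sum => k _; case: phi.
by have := leq_ltn_trans (leq_trans lj (win js)) ljs; rewrite ltnn.
Qed.

End tournament_analysis.

Section huber_contamination.
Context (R : realType) (d d' : measure_display) (Omega : measurableType d)
  (T : measurableType d') (Pr : probability Omega R) (n : nat)
  (Z : 'I_n -> {RV Pr >-> T}) (eps : R) (P Q : probability T R).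
Hypothesis eps01 : 0 <= eps <= 1.

Definition contaminated (B : set T) : R :=
  (1 - eps) * fine (P B) + eps * fine (Q B).

Lemma contaminated01 B : measurable B -> 0 <= contaminated B <= 1.
Proof.
move=> mB; have /andP[e0 e1] := eps01; rewrite /contaminated.
have /andP[? ?] := fine_prob01 P mB; have /andP[? ?] := fine_prob01 Q mB.
by apply/andP; split; nra.
Qed.

Lemma contaminated_dist B : measurable B -> `|contaminated B - fine (P B)| <= eps.
Proof.
move=> mB; have /andP[e0 e1] := eps01; rewrite /contaminated.
have /andP[? ?] := fine_prob01 P mB; have /andP[? ?] := fine_prob01 Q mB.
by rewrite ler_norml; apply/andP; split; nra.
Qed.

Hypothesis hub : huber_sample Z eps P Q.

Lemma huber_law B : measurable B -> forall i, Pr (Z i @^-1` B) = (contaminated B)%:E.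
Proof.
move=> mB i; have := hub.1 i B mB; rewrite /distribution /pushforward => ->.
have fin S : (S : probability T R) B = (fine (S B))%:E.
  by rewrite fineK// fin_num_measure.
by rewrite (fin P) (fin Q) -!EFinM -EFinD.
Qed.

Lemma huber_indep (F : 'I_n -> set T) : (forall i, measurable (F i)) ->
  Pr (\bigcap_i (Z i @^-1` F i)) = (\prod_i Pr (Z i @^-1` F i))%E.
Proof.
move=> mF; have := hub.2 [set: 'I_n]%SET F mF.
rewrite (eq_bigl xpredT) => [<-|i]; last by rewrite inE.
by congr (Pr _); apply: eq_bigcapl; split=> i // _; rewrite /= inE.
Qed.

End huber_contamination.

(** Risk bound in total variation from a local entropy condition: with
    [v = n * delta ^ 2] and distances [y] measured in units of [delta], matches
    between the ball and a point at distance [y] fail with probability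
    [exp (- c * v * y ^ 2)], while the condition bounds the number of such
    points by [exp (kap * v * y)]. *)
Theorem tournament_risk (R : realType) (C0 d1 : R) : 0 < C0 -> 0 < d1 ->
  exists K C' : R, [/\ 0 < K, 0 < C' &
  forall (d : measure_display) (T : measurableType d) (Theta : Type)
    (P : Theta -> probability T R) (p : Theta -> T -> R)
    (mu : {measure set T -> \bar R}) (m : nat) (a : 'I_m -> Theta) (t : Theta)
    (n : nat) (D delta eps : R) (Q : probability T R)
    (d' : measure_display) (Omega : measurableType d')
    (Pr : probability Omega R) (Z : 'I_n -> {RV Pr >-> T}),
  (0 < n)%N -> 1 <= D -> 0 < delta -> d1 ^+ 2 * D <= n%:R * delta ^+ 2 ->
  (forall j, is_density mu (P (a j)) (p (a j))) ->
  (exists j, tv (P t) (P (a j)) <= delta) ->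
  (forall l : nat, (0 < l)%N ->
     #|[pred j | tv (P t) (P (a j)) <= l%:R * delta]|%:R <=
       expR (C0 * D * l%:R)) ->
  0 <= eps <= 1 ->
  huber_sample Z eps (P t) Q ->
  exists E : set Omega, [/\ measurable E,
    (forall w, E w -> forall u,
      tournament_winner P p a (fun i => Z i w) u ->
      tv (P t) (P u) <= K * (delta + eps)) &
    ((1 - expR (- (C' * (D + n%:R * eps ^+ 2))))%:E <= Pr E)%E]].
Proof.
move=> C00 d10; pose kap := C0 / d1 ^+ 2.
have d20 : 0 < d1 ^+ 2 by exact: exprn_gt0.
have kap0 : 0 < kap by exact: divr_gt0.
(* deviations of [y / 8] enter the Chernoff bound [n * s ^ 2 / 8] *)
have [c [c0 cE]] : exists c : R, 0 < c /\ c = (2 ^+ 9)^-1.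
  by exists (2 ^+ 9)^-1; rewrite invr_gt0 exprn_gt0.
have [K0 [K04 K0k K0d]] : exists K0 : R,
    [/\ 4 <= K0, 64 * kap <= c * K0 & 192 <= c * d1 ^+ 2 * K0].
  have cd0 : 0 < c * d1 ^+ 2 by exact: mulr_gt0.
  have kc0 : 0 < 64 * kap / c by rewrite divr_gt0// mulr_gt0.
  have dc0 : 0 < 192 / (c * d1 ^+ 2) by exact: divr_gt0.
  exists (4 + 64 * kap / c + 192 / (c * d1 ^+ 2)); split; first by lra.
    by rewrite -ler_pdivrMl// mulrC; lra.
  by rewrite -ler_pdivrMl// mulrC; lra.
have K00 : 0 < K0 by lra.
exists (5 * K0), (c / 64 * K0 ^+ 2 * Num.min 1 (d1 ^+ 2)).
have min0 : 0 < Num.min 1 (d1 ^+ 2) by rewrite lt_min ltr01.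
split; [exact: mulr_gt0 | by rewrite !mulr_gt0// exprn_gt0 |].
move=> d T Theta P p mu m a t n D delta eps Q d' Omega Pr Z n0 D1 delta0 hD
  dens [js hjs] hcount eps01 hub.
have eps0 : 0 <= eps by case/andP: eps01.
have de0 : 0 <= delta + eps by rewrite addr_ge0// ltW.
pose dist j := tv (P t) (P (a j)).
pose rho := K0 * (delta + eps).
have rho_delta : K0 * delta <= rho by rewrite /rho ler_pM2l// lerDl.
have rho0 : 0 < rho by apply: lt_le_trans rho_delta; rewrite mulr_gt0.
pose q := contaminated eps (P t) Q.
have mT j k := measurable_test_set dens j k.
pose dev (B : set T) (s : R) := [set w | s < `|empirical R (fun i => Z i w) B - q B|].
have mdev B s : measurable B -> measurable (dev B s).
  move=> mB.
  exact: (measurable_empirical_preimage Z mB [set y | s < `|y - q B|]).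
pose G := [pred g | dist g <= rho].
pose far := [pred j | rho < dist j].
pose fail (gj : 'I_m * 'I_m) :=
  dev (test_set p a gj.1 gj.2) (dist gj.2 / 8) `|`
  dev (test_set p a gj.2 gj.1) (dist gj.2 / 8).
have mfail gj : measurable (fail gj) by apply: measurableU; exact: mdev.
pose Bad := \bigcup_(gj in [set gj : 'I_m * 'I_m | G gj.1 && far gj.2]) fail gj.
have mBad : measurable Bad by apply: fin_bigcup_measurable.
exists (~` Bad); split; first exact: measurableC.
  move=> w nB u win; rewrite -mulrA -/rho.
  apply: (winner_near dens (ltW delta0) eps0 _ rho0 hjs
    (contaminated_dist (P t) Q eps01) _ win); first by rewrite /rho ler_wpM2r.
  move=> g j hg hj; split; rewrite leNgt; apply/negP => h; apply: nB;
    exists (g, j) => /=; rewrite ?hg ?hj//; [left|right]; exact: h.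
pose v := n%:R * delta ^+ 2; pose y j := dist j / delta; pose r' := rho / delta.
have nR0 : 0 < n%:R :> R by rewrite ltr0n.
have v0 : 0 < v by rewrite mulr_gt0// exprn_gt0.
have vD : d1 ^+ 2 <= v by apply: le_trans hD; rewrite ler_peMr// ltW.
have r'E : r' * delta = rho by rewrite divfK// gt_eqF.
have r'K : K0 <= r' by rewrite ler_pdivlMr.
have yG j : (y j <= r') = G j by rewrite ler_pM2r ?invr_gt0.
have yfar j : (r' < y j) = far j by rewrite ltr_pM2r ?invr_gt0.
have pairs : #|G|%:R * \sum_(j | far j) expR (- (c * v * y j ^+ 2)) <=
    2 * expR (- (c / 32 * (n%:R * rho ^+ 2))).
  have -> : c / 32 * (n%:R * rho ^+ 2) = c / 32 * v * r' ^+ 2.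
    by rewrite /v -r'E; field.
  rewrite -(eq_bigl _ _ yfar) -(eq_card (A := [pred j | y j <= r'])); last first.
    by move=> j; rewrite !inE yG.
  apply: (ball_times_far_sum (kap := kap)) => //.
  - exact: ltW.
  - by move=> j; rewrite divr_ge0 ?tv_ge0// ltW.
  - by apply: le_trans r'K; apply: le_trans K04; rewrite ler_nat.
  - by apply: (le_trans K0k); rewrite ler_pM2l.
  - apply: (@le_trans _ _ (c * d1 ^+ 2 * K0)).
      by apply: le_trans K0d; rewrite ler_nat.
    have := ler_wpM2l (ltW c0) (ler_pM (ltW d20) (ltW K00) vD r'K).
    by rewrite !mulrA.
  - move=> l l0; rewrite (eq_card (B := [pred j | dist j <= l%:R * delta])).
      apply: (le_trans (hcount l l0)); rewrite ler_expR ler_wpM2r//.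
      by rewrite /kap -mulrA ler_pM2l// mulrC ler_pdivlMr// mulrC.
    by move=> j; rewrite !inE ler_pdivrMr.
have PrBad : (Pr Bad <= (8 * expR (- (c / 32 * (n%:R * rho ^+ 2))))%:E)%E.
  apply: (le_trans (measure_le_sum Pr (P := fun gj => G gj.1 && far gj.2)
    (F := fail) mBad (fun gj _ => mfail gj) _)).
    by move=> w [gj]; exists gj.
  apply: (@le_trans _ _ (\sum_(gj : 'I_m * 'I_m | G gj.1 && far gj.2)
      (4 * expR (- (c * v * y gj.2 ^+ 2)))%:E)%E).
    apply: lee_sum => gj /andP[_ hj].
    apply: (le_trans (measureU2 _ (mdev _ _ (mT _ _)) (mdev _ _ (mT _ _)))).
    have s01 : 0 < dist gj.2 / 8 <= 1.
      apply/andP; split; first by rewrite divr_gt0// (lt_trans rho0).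
      by rewrite ler_pdivrMr// mul1r (le_trans (tv_le1 _ _))// ler1n.
    have ch B : measurable B -> (Pr (dev B (dist gj.2 / 8)%R) <=
        (2 * expR (- (c * v * y gj.2 ^+ 2)))%:E)%E.
      move=> mB; have := chernoff_two_sided mB (contaminated01 (P t) Q eps01 mB)
        (huber_law hub mB) (huber_indep hub) n0 s01.
      congr (_ <= (2 * expR (- _))%:E)%E.
      by rewrite cE /v /y; field; rewrite lt0r_neq0.
    have -> : 4 * expR (- (c * v * y gj.2 ^+ 2)) =
      2 * expR (- (c * v * y gj.2 ^+ 2)) + 2 * expR (- (c * v * y gj.2 ^+ 2)) by ring.
    by rewrite EFinD; apply: leeD; exact: ch.
  rewrite sumEFin lee_fin -(pair_big G far
    (fun _ j => 4 * expR (- (c * v * y j ^+ 2)))) /=.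
  rewrite -mulr_sumr sumr_const -(mulr_natl (4 * _)) mulrCA.
  apply: (le_trans (ler_wpM2l (ler0n R 4) pairs)).
  by rewrite le_eqVlt; apply/orP; left; apply/eqP; ring.
rewrite probability_setC// EFinB leeB// (le_trans PrBad)// lee_fin.
exact: tournament_exponent (ltW delta0) eps0 hD.
Qed.

(** * Normal laws *)

Section normal_bounds.
Context (R : realType).
Implicit Types (m s x : R).
Local Notation leb := (@lebesgue_measure R).

(** Integration against a density, through uniqueness of the Radon-Nikodym
    derivative. *)
Lemma ge0_integral_normal_prob m s (f : measurableTypeR R -> \bar R) :
  measurable_fun setT f -> (forall x, 0 <= f x)%E ->
  (\int[normal_prob m s]_x f x = \int[leb]_x (f x * (normal_pdf m s x)%:E))%E.
Proof.
move=> mf f0; have dom := normal_prob_dominates m s.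
have mpdf : measurable_fun setT (fun x => (normal_pdf m s x)%:E).
  by apply/measurable_EFinP; exact: measurable_normal_pdf.
rewrite -(Radon_Nikodym_SigmaFinite.change_of_variables dom)//.
have iRN := Radon_Nikodym_SigmaFinite.f_integrable dom.
apply: ae_eq_integral => //.
- by apply: emeasurable_funM => //; exact: measurable_int iRN.
- exact: emeasurable_funM.
- apply: ae_eqe_mul2l; apply: integral_ae_eq => //.
  by move=> E _ mE; rewrite -Radon_Nikodym_SigmaFinite.f_integral.
Qed.

Lemma normal_pdf_scale m s x : 0 < s ->
  normal_pdf m s x * ((x - m) / s) ^+ 2 <= 6 * normal_pdf m (Num.sqrt 2 * s) x.
Proof.
move=> s0; have r20 : 0 < Num.sqrt 2 :> R by rewrite sqrtr_gt0.
rewrite !normal_pdfE ?gt_eqF// ?mulr_gt0//.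
set u := (x - m) / s.
have pk : normal_peak s = Num.sqrt 2 * normal_peak (Num.sqrt 2 * s).
  rewrite /normal_peak exprMn sqr_sqrtr//.
  have -> : 2 * s ^+ 2 * pi *+ 2 = 2 * (s ^+ 2 * pi *+ 2) :> R by ring.
  rewrite sqrtrM//.
  by rewrite invfM mulVKf// gt_eqF.
have e1 : normal_fun m s x = expR (- (u ^+ 2 / 4)) * expR (- (u ^+ 2 / 4)).
  rewrite -expRD /normal_fun; congr expR; rewrite /u; field; exact: lt0r_neq0.
have e2 : normal_fun m (Num.sqrt 2 * s) x = expR (- (u ^+ 2 / 4)).
  rewrite /normal_fun exprMn sqr_sqrtr//; congr expR; rewrite /u; field.
  exact: lt0r_neq0.
rewrite pk e1 e2; set e := expR _; set k := normal_peak _.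
have k0 : 0 <= k by exact: normal_peak_ge0.
have e0 : 0 < e by exact: expR_gt0.
have h : e * (u ^+ 2 / 4) <= 1.
  rewrite -[leRHS](expR0 R) -(subrr (u ^+ 2 / 4)) addrC expRD ler_pM2l//.
  by apply: le_trans (expR_ge1Dx _); rewrite lerDr.
have r2 : Num.sqrt 2 <= 3 / 2 :> R.
  by rewrite -(@ler_pXn2r _ 2)// ?nnegrE ?ltW// sqr_sqrtr//; lra.
have h2 : e * e * u ^+ 2 <= 4 * e by nra.
rewrite -!mulrA [leRHS]mulrCA [X in X <= _]mulrCA ler_wpM2l//.
rewrite mulrA.
apply: (@le_trans _ _ (Num.sqrt 2 * (4 * e))).
  by rewrite ler_pM2l// mulrA.
by rewrite mulrA ler_pM2r//; lra.
Qed.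

(** No integration by parts: [u ^ 2 * exp (- u ^ 2 / 2)] is at most
    [4 * exp (- u ^ 2 / 4)], a multiple of a normal density of doubled
    variance. *)
Lemma normal_second_moment m s : 0 < s ->
  (\int[leb]_x (normal_pdf m s x * ((x - m) / s) ^+ 2)%:E <= 6%:E)%E.
Proof.
move=> s0.
apply: (@le_trans _ _ (\int[leb]_x (6%:E * (normal_pdf m (Num.sqrt 2 * s) x)%:E))%E).
  apply: ge0_le_integral => //.
  - by move=> x _; rewrite lee_fin mulr_ge0 ?normal_pdf_ge0 ?sqr_ge0.
  - apply/measurable_EFinP; apply: measurable_funM.
      exact: measurable_normal_pdf.
    by apply: measurable_funX; apply: measurable_funM => //; exact: measurable_funB.
  - apply: emeasurable_funM => //; apply/measurable_EFinP.
    exact: measurable_normal_pdf.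
  - by move=> x _; rewrite lee_fin normal_pdf_scale.
rewrite ge0_integralZl//.
- by rewrite integral_normal_pdf mule1.
- by apply/measurable_EFinP; exact: measurable_normal_pdf.
- by move=> x _; rewrite lee_fin normal_pdf_ge0.
Qed.

(** The density ratio is [exp (u * y - u ^ 2 / 2)] with [u] the shift and [y]
    the point, both in standard units, and [exp x >= 1 + x]. The cross term
    [u * y] is split with a weight [lam], to be chosen of order [1 / u] once [u]
    is averaged. *)
Lemma normal_prob_le_shift (a b s lam : R) (F : set (measurableTypeR R)) :
  0 < s -> 0 < lam -> measurable F ->
  (normal_prob a s F <= normal_prob b s F +
    ((lam + 1) * ((b - a) / s) ^+ 2 + 6 / lam)%:E)%E.
Proof.
move=> s0 lam0 mF.
set u := (b - a) / s.
have mp c : measurable_fun setT (fun x => (normal_pdf c s x)%:E).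
  by apply/measurable_EFinP; exact: measurable_normal_pdf.
have mpa := mp a; have mpb := mp b.
have mq : measurable_fun setT (fun x => (normal_pdf a s x * ((x - a) / s) ^+ 2)%:E).
  apply/measurable_EFinP; apply: measurable_funM.
    exact: measurable_normal_pdf.
  by apply: measurable_funX; apply: measurable_funM => //; exact: measurable_funB.
have q0 x : (0 <= (normal_pdf a s x * ((x - a) / s) ^+ 2)%:E)%E.
  by rewrite lee_fin mulr_ge0 ?normal_pdf_ge0 ?sqr_ge0.
have p0 c x : (0 <= (normal_pdf c s x)%:E)%E by rewrite lee_fin normal_pdf_ge0.
have ptw x : ((normal_pdf a s x)%:E <= (normal_pdf b s x)%:E +
    (((lam + 1) * u ^+ 2)%:E * (normal_pdf a s x)%:E +
     (lam^-1)%:E * (normal_pdf a s x * ((x - a) / s) ^+ 2)%:E))%E.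
  rewrite -!EFinM -!EFinD lee_fin.
  set y := (x - a) / s.
  have e1 : normal_pdf b s x = normal_pdf a s x * expR (u * y - u ^+ 2 / 2).
    rewrite !normal_pdfE ?gt_eqF// -mulrA -expRD; congr (_ * expR _).
    by rewrite /u /y; field; exact: lt0r_neq0.
  have h := expR_ge1Dx (u * y - u ^+ 2 / 2).
  have lam1 : lam * lam^-1 = 1 by rewrite divff// gt_eqF.
  have li0 : 0 < lam^-1 by rewrite invr_gt0.
  have h2 : - (u * y) <= lam * u ^+ 2 + lam^-1 * y ^+ 2.
    have : 0 <= lam^-1 * (lam * u + y) ^+ 2 by rewrite mulr_ge0 ?sqr_ge0// ltW.
    have -> : lam^-1 * (lam * u + y) ^+ 2 = (lam * lam^-1) * (lam * u ^+ 2)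
       + 2 * (lam * lam^-1) * (u * y) + lam^-1 * y ^+ 2 by ring.
    rewrite lam1.
    have := mulr_ge0 (ltW lam0) (sqr_ge0 u).
    have := mulr_ge0 (ltW li0) (sqr_ge0 y); lra.
  rewrite e1; set p := normal_pdf a s x; set e := expR _ in h *.
  have p00 : 0 <= p by exact: normal_pdf_ge0.
  have : p * (1 - e) <= p * ((lam + 1) * u ^+ 2 + lam^-1 * y ^+ 2).
    by rewrite ler_wpM2l//; have := sqr_ge0 u; lra.
  lra.
rewrite /normal_prob.
apply: (@le_trans _ _ (\int[leb]_(x in F) ((normal_pdf b s x)%:E +
    (((lam + 1) * u ^+ 2)%:E * (normal_pdf a s x)%:E +
     (lam^-1)%:E * (normal_pdf a s x * ((x - a) / s) ^+ 2)%:E)))%E).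
  apply: ge0_le_integral => //.
  - exact: measurable_funTS.
  - apply: measurable_funTS; apply: emeasurable_funD => //.
    by apply: emeasurable_funD; apply: emeasurable_funM.
have cu0 : (0 <= ((lam + 1) * u ^+ 2)%:E)%E.
  by rewrite lee_fin mulr_ge0 ?sqr_ge0//; lra.
have li0 : (0 <= (lam^-1)%:E)%E by rewrite lee_fin invr_ge0 ltW.
rewrite ge0_integralD//; last 3 first.
- exact: measurable_funTS.
- by move=> x _; rewrite adde_ge0// mule_ge0.
- by apply: measurable_funTS; apply: emeasurable_funD; apply: emeasurable_funM.
rewrite leeD2l// ge0_integralD//; last 4 first.
- by move=> x _; rewrite mule_ge0.
- by apply: measurable_funTS; apply: emeasurable_funM.
- by move=> x _; rewrite mule_ge0.
- by apply: measurable_funTS; apply: emeasurable_funM.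
rewrite EFinD; apply: leeD.
  rewrite ge0_integralZl//; last exact: measurable_funTS.
  rewrite -[leRHS]mule1 lee_wpmul2l// -(integral_normal_pdf a s).
  by apply: ge0_subset_integral.
rewrite ge0_integralZl//; last exact: measurable_funTS.
rewrite mulrC EFinM lee_wpmul2l//.
apply: le_trans (normal_second_moment a s0).
by apply: ge0_subset_integral.
Qed.

(** A lower bound, common to all normal laws, for the mass between one and two
    standard deviations above the mean. *)
Definition normal_box : R := normal_peak 1 * expR (- 2).

Lemma normal_box_gt0 : 0 < normal_box.
Proof. by rewrite mulr_gt0 ?expR_gt0// normal_peak_gt0// oner_neq0. Qed.

Lemma normal_prob_box m s : 0 < s ->
  (normal_box%:E <= normal_prob m s `[(m + s)%R, (m + 2 * s)%R])%E.
Proof.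
move=> s0; rewrite /normal_prob.
have pk : normal_peak 1 = s * normal_peak s.
  rewrite /normal_peak expr1n mul1r -mulrnAr sqrtrM ?sqr_ge0//.
  by rewrite sqrtr_sqr gtr0_norm// invfM mulVKf// gt_eqF.
apply: (@le_trans _ _ (\int[leb]_(x in `[(m + s)%R, (m + 2 * s)%R])
    (normal_peak s * expR (- 2))%:E)%E).
  rewrite integral_cst//= lebesgue_measure_itv/= lte_fin.
  have -> : m + s < m + 2 * s by lra.
  rewrite -EFinD -EFinM lee_fin /normal_box pk.
  by rewrite le_eqVlt; apply/orP; left; apply/eqP; ring.
apply: ge0_le_integral => //.
- by move=> x _; rewrite lee_fin mulr_ge0 ?expR_ge0 ?normal_peak_ge0.
- by apply/measurable_EFinP/measurable_funTS; exact: measurable_normal_pdf.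
- move=> x; rewrite /= in_itv/= => /andP[x1 x2]; rewrite lee_fin.
  rewrite normal_pdfE ?gt_eqF// ler_wpM2l ?normal_peak_ge0// ler_expR.
  rewrite mulNr lerN2 ler_pdivrMr; last by rewrite mulrn_wgt0// exprn_gt0.
  have : (x - m) ^+ 2 <= (2 * s) ^+ 2.
    by rewrite lerXn2r ?nnegrE//; lra.
  by rewrite mulr2n; nra.
Qed.

(** For [a - b >= s * t] the second density is smaller than the first by a
    factor [exp (- t)] to the right of [a + s]. *)
Lemma normal_prob_box_shift (a b s t : R) : 0 < s -> 0 <= t -> s * t <= a - b ->
  (normal_prob b s `[(a + s)%R, (a + 2 * s)%R] <=
   (expR (- t))%:E * normal_prob a s `[(a + s)%R, (a + 2 * s)%R])%E.
Proof.
move=> s0 t0 hab; rewrite /normal_prob -ge0_integralZl//.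
- apply: ge0_le_integral => //.
  + by move=> x _; rewrite lee_fin normal_pdf_ge0.
  + by apply/measurable_EFinP/measurable_funTS; exact: measurable_normal_pdf.
  + apply: emeasurable_funM => //.
    by apply/measurable_EFinP/measurable_funTS; exact: measurable_normal_pdf.
  + move=> x; rewrite /= in_itv/= => /andP[x1 x2]; rewrite -EFinM lee_fin.
    rewrite !normal_pdfE ?gt_eqF// mulrCA ler_wpM2l ?normal_peak_ge0//.
    rewrite -expRD ler_expR.
    rewrite !mulNr -opprD lerN2.
    have s20 : 0 < s ^+ 2 *+ 2 by rewrite mulrn_wgt0// exprn_gt0.
    rewrite -lerBrDr -mulrBl ler_pdivlMr// mulr2n.
    have := mulr_ge0 (ltW s0) t0; nra.
- by apply/measurable_EFinP/measurable_funTS; exact: measurable_normal_pdf.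
- by move=> x _; rewrite lee_fin normal_pdf_ge0.
Qed.

End normal_bounds.

(** * Total variation in the regression model *)

Section fine_le.
Context (R : realType).
Implicit Types (x y : \bar R) (c : R).

Lemma fine_leD x y c : x \is a fin_num -> y \is a fin_num ->
  (x <= y + c%:E)%E -> fine x <= fine y + c.
Proof. by case: x => // x; case: y. Qed.

Lemma fine_leM x y c : x \is a fin_num -> y \is a fin_num ->
  (x <= c%:E * y)%E -> fine x <= c * fine y.
Proof. by case: x => // x; case: y. Qed.

Lemma fine_ge x c : x \is a fin_num -> (c%:E <= x)%E -> c <= fine x.
Proof. by case: x. Qed.

Lemma gap_le (a b e q : R) :
  0 <= 1 - e -> q <= a -> b <= e * a -> q * (1 - e) <= a - b.
Proof. by move=> e1 qa bea; have := ler_wpM2r e1 qa; lra. Qed.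

Lemma dist_le (a b c : R) : a <= b + c -> b <= a + c -> `|a - b| <= c.
Proof. by move=> ab ba; rewrite ler_norml; apply/andP; split; lra. Qed.

End fine_le.

Section integral_comparison.
Context (R : realType) (d : measure_display) (T : measurableType d)
  (P : probability T R).
Implicit Types f g h : T -> \bar R.

Lemma integral_le_affine f g h (a b c : R) : 0 <= a -> 0 <= b ->
  measurable_fun setT f -> measurable_fun setT g -> measurable_fun setT h ->
  (forall x, 0 <= f x)%E -> (forall x, 0 <= g x)%E -> (forall x, 0 <= h x)%E ->
  (forall x, f x <= g x + (a%:E * h x + b%:E))%E ->
  (\int[P]_x h x <= c%:E)%E ->
  (\int[P]_x f x <= \int[P]_x g x + (a * c + b)%:E)%E.
Proof.
move=> a0 b0 mf mg mh f0 g0 h0 fgh hc.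
have aE : (0 <= a%:E)%E by rewrite lee_fin.
have bE : (0 <= b%:E)%E by rewrite lee_fin.
have mah : measurable_fun setT (fun x => (a%:E * h x)%E) by exact: emeasurable_funM.
apply: (@le_trans _ _ (\int[P]_x (g x + (a%:E * h x + b%:E)))%E).
  apply: ge0_le_integral => //.
  by apply: emeasurable_funD => //; exact: emeasurable_funD.
rewrite ge0_integralD//; last 2 first.
- by move=> x _; rewrite adde_ge0// mule_ge0.
- exact: emeasurable_funD.
rewrite leeD2l// ge0_integralD//; last by move=> x _; rewrite mule_ge0.
rewrite integral_cst// [X in (_ + _ * X <= _)%E]probability_setT mule1.
by rewrite ge0_integralZl// EFinD EFinM leeD2r// lee_wpmul2l.
Qed.

Lemma integral_le_scale f g (a : R) : 0 <= a ->
  measurable_fun setT f -> measurable_fun setT g ->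
  (forall x, 0 <= f x)%E -> (forall x, 0 <= g x)%E ->
  (forall x, f x <= a%:E * g x)%E ->
  (\int[P]_x f x <= a%:E * \int[P]_x g x)%E.
Proof.
move=> a0 mf mg f0 g0 fg; rewrite -ge0_integralZl ?lee_fin//.
by apply: ge0_le_integral => //; exact: emeasurable_funM.
Qed.

Lemma integral_ge_cst_on f (D : set T) (a b : R) : 0 <= a ->
  measurable D -> measurable_fun setT f -> (forall x, 0 <= f x)%E ->
  (forall x, D x -> a%:E <= f x)%E -> (b%:E <= P D)%E ->
  ((a * b)%:E <= \int[P]_x f x)%E.
Proof.
move=> a0 mD mf f0 af bD.
apply: (@le_trans _ _ (\int[P]_(x in D) a%:E)%E).
  by rewrite integral_cst// EFinM lee_wpmul2l ?lee_fin.
apply: (@le_trans _ _ (\int[P]_(x in D) f x)%E).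
  apply: ge0_le_integral => //; exact: measurable_funTS.
exact: ge0_subset_integral.
Qed.

End integral_comparison.

Section regression_tv.
Context (R : realType) (p1 p2 : nat).
Implicit Types A B C X : 'M[R]_(p1, p2).

Lemma tr_mul_vec X C : \tr (X^T *m C) = ((vec C)^T *m vec X) 0 0.
Proof.
rewrite /vec trmxK [RHS]mxE /mxtrace.
rewrite (reindex (uncurry (@mxvec_index p1 p2))) /=; last first.
  exact: curry_mxvec_bij.
rewrite (eq_bigr (fun ij => C ij.1 ij.2 * X ij.1 ij.2)); last first.
  by move=> [i j] _ /=; rewrite mxE !mxvecE.
rewrite -(pair_bigA _ (fun i j => C i j * X i j)) /= exchange_big /=.
by apply: eq_bigr => j _; rewrite mxE; apply: eq_bigr => i _; rewrite mxE mulrC.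
Qed.

Lemma vecN C : vec (- C) = - vec C.
Proof. by rewrite /vec !linearN. Qed.

Lemma measurable_tr C :
  measurable_fun setT (fun X => \tr (X^T *m C) : measurableTypeR R).
Proof.
rewrite /mxtrace; apply: measurable_sum => i.
rewrite (_ : (fun _ => _) = fun X => \sum_j X j i * C j i); last first.
  by apply/funext => X; rewrite mxE; apply: eq_bigr => j _; rewrite mxE.
by apply: measurable_sum => j; apply: measurable_funM => //; exact: measurable_entry.
Qed.

Context (PX : probability 'M[R]_(p1, p2) R) (Sigma : 'M[R]_(p1 * p2)) (sigma : R).
Hypotheses (gPX : gaussian_mx Sigma PX) (sigma0 : 0 < sigma).

Section pair.
Context (A B : 'M[R]_(p1, p2)) (tau : R).
Hypotheses (tau0 : 0 < tau)
  (tauE : ((vec (A - B))^T *m Sigma *m vec (A - B)) 0 0 = tau ^+ 2).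

Let W X : measurableTypeR R := \tr (X^T *m (A - B)).

Let mW : measurable_fun setT W. Proof. exact: measurable_tr. Qed.

Let WE X : W X = \tr (X^T *m A) - \tr (X^T *m B).
Proof. by rewrite /W mulmxBr raddfB. Qed.

Let lawW (D : set (measurableTypeR R)) : measurable D ->
  PX (W @^-1` D) = normal_prob 0 tau D.
Proof.
move=> mD; have := gPX (vec (A - B)) mD.
rewrite tauE /centered_normal expf_eq0 /= (gt_eqF tau0) sqrtr_sqr gtr0_norm//.
move=> <-; congr (PX _); apply/seteqP.
by split => X /=; rewrite /W tr_mul_vec.
Qed.

Lemma gaussian_second_moment :
  (\int[PX]_X ((W X / tau) ^+ 2)%:E <= 6%:E)%E.
Proof.
pose f (w : measurableTypeR R) := ((w / tau) ^+ 2)%:E.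
have mf : measurable_fun setT f.
  apply/measurable_EFinP; apply: measurable_funX.
  exact: measurable_funM.
have f0 w : (0 <= f w)%E by rewrite lee_fin sqr_ge0.
rewrite -[leLHS](_ : (\int[pushforward PX W]_w f w)%E = _); last first.
  by rewrite ge0_integral_pushforward.
rewrite (eq_measure_integral (normal_prob 0 tau)) => [|D mD _]; last exact: lawW.
rewrite ge0_integral_normal_prob//.
apply: le_trans (normal_second_moment 0 tau0).
rewrite le_eqVlt; apply/orP; left; apply/eqP; apply: eq_integral => x _.
by rewrite /f -EFinM subr0 mulrC.
Qed.

(** [normal_prob_le_shift] averaged over [X], with weight [lam = sigma / tau]. *)
Lemma regression_law_le_shift (E : set (obs R p1 p2)) : measurable E ->
  fine (regression_law PX sigma A E) <= fine (regression_law PX sigma B E) +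
    (12 * (tau / sigma) + 6 * (tau / sigma) ^+ 2).
Proof.
move=> mE; set t := tau / sigma.
have t0 : 0 < t by exact: divr_gt0.
have fin C : regression_law PX sigma C E \is a fin_num by exact: fin_num_measure.
apply: (fine_leD (fin A) (fin B)); rewrite /regression_law.
have mk C := measurable_regression_kernel sigma C mE.
have mkA := mk A; have mkB := mk B.
have mW2 : measurable_fun setT (fun X => ((W X / tau) ^+ 2)%:E).
  apply/measurable_EFinP; apply: measurable_funX.
  exact: measurable_funM.
have c0 : 0 <= (t^-1 + 1) * t ^+ 2.
  by rewrite mulr_ge0 ?sqr_ge0// addr_ge0// invr_ge0 ltW.
have t6 : 0 <= 6 * t by rewrite mulr_ge0// ltW.
have -> : 12 * t + 6 * t ^+ 2 = (t^-1 + 1) * t ^+ 2 * 6 + 6 * t.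
  by field; rewrite lt0r_neq0.
have kA0 X : (0 <= normal_prob (\tr (X^T *m A)) sigma (xsection E X))%E by [].
have kB0 X : (0 <= normal_prob (\tr (X^T *m B)) sigma (xsection E X))%E by [].
apply: (integral_le_affine c0 t6 mkA mkB mW2 kA0 kB0 _ _ gaussian_second_moment).
  by move=> X; rewrite lee_fin sqr_ge0.
move=> X; have mX : measurable (xsection E X) by exact: measurable_xsection.
apply: (le_trans (normal_prob_le_shift (\tr (X^T *m A)) (\tr (X^T *m B))
  sigma0 (_ : 0 < t^-1) mX)); first by rewrite invr_gt0.
rewrite leeD2l// -EFinM -EFinD lee_fin invrK lerD2r.
rewrite le_eqVlt; apply/orP; left; apply/eqP.
by rewrite WE /t; field; rewrite !lt0r_neq0.
Qed.

(** The test set asks for [W] in [[tau, 2 * tau]], which has positive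
    probability, and for [y] to exceed its mean under [A] by one to two standard
    deviations, where the density under [B] is smaller by a factor
    [exp (- W / sigma)]. *)
Lemma regression_tv_ge :
  normal_box R ^+ 2 * (1 - expR (- (tau / sigma))) <=
  tv (regression_law PX sigma A) (regression_law PX sigma B).
Proof.
set t := tau / sigma; have t0 : 0 < t by exact: divr_gt0.
pose D : set 'M[R]_(p1, p2) := W @^-1` `[tau, 2 * tau].
pose E : set (obs R p1 p2) := (D `*` setT) `&`
  [set z | sigma <= z.2 - \tr (z.1^T *m A) <= 2 * sigma].
have mD : measurable D.
  by rewrite -[D]setTI; apply: mW => //; exact: measurable_itv.
have mE : measurable E.
  apply: measurableI; first exact: measurableX.
  have mg : measurable_fun setT
      (fun z : obs R p1 p2 => z.2 - \tr (z.1^T *m A) : measurableTypeR R).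
    apply: measurable_funB => //.
    exact: (measurableT_comp (measurable_tr A)).
  rewrite (_ : [set z | _] = setT `&`
    (fun z : obs R p1 p2 => z.2 - \tr (z.1^T *m A)) @^-1` `[sigma, 2 * sigma]).
    by apply: mg => //; exact: measurable_itv.
  by rewrite setTI; apply/seteqP; split => z /=; rewrite in_itv.
have secE X : D X -> xsection E X =
    `[(\tr (X^T *m A) + sigma)%R, (\tr (X^T *m A) + 2 * sigma)%R]%classic.
  move=> DX; apply/seteqP; split => y; rewrite /xsection /= inE /E /= in_itv /=.
    by move=> [_]; lra.
  by move=> h; split => //; lra.
have sec0 X : ~ D X -> xsection E X = set0.
  move=> nDX; apply/seteqP; split => y //; rewrite /xsection /= inE /E /=.
  by move=> [[/nDX]].
have fin C : regression_law PX sigma C E \is a fin_num by exact: fin_num_measure.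
have mk C := measurable_regression_kernel sigma C mE.
have mkA := mk A; have mkB := mk B.
have hB : fine (regression_law PX sigma B E) <=
    expR (- t) * fine (regression_law PX sigma A E).
  apply: (fine_leM (fin B) (fin A)); rewrite /regression_law.
  have kA0 X : (0 <= normal_prob (\tr (X^T *m A)) sigma (xsection E X))%E by [].
  have kB0 X : (0 <= normal_prob (\tr (X^T *m B)) sigma (xsection E X))%E by [].
  apply: (integral_le_scale PX (expR_ge0 (- t)) mkB mkA kB0 kA0) => X.
  have [DX|nDX] := pselect (D X); last by rewrite sec0// !measure0 mule0.
  rewrite secE//; apply: normal_prob_box_shift => //; first exact: ltW.
  rewrite -WE /t mulrCA divff ?gt_eqF// mulr1.
  by move: DX; rewrite /D /= in_itv /= => /andP[].
have hA : normal_box R ^+ 2 <= fine (regression_law PX sigma A E).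
  apply: (fine_ge (fin A)); rewrite /regression_law expr2.
  have hD : ((normal_box R)%:E <= PX D)%E.
    have := normal_prob_box 0 tau0; rewrite !add0r.
    by rewrite -(lawW (measurable_itv _)).
  have kA0 X : (0 <= normal_prob (\tr (X^T *m A)) sigma (xsection E X))%E by [].
  have kAD X : D X ->
      ((normal_box R)%:E <= normal_prob (\tr (X^T *m A)) sigma (xsection E X))%E.
    by move=> DX; rewrite secE//; exact: normal_prob_box.
  exact: (integral_ge_cst_on (ltW (normal_box_gt0 R)) mD mkA kA0 kAD hD).
apply: le_trans (tv_ge _ _ mE); apply: le_trans (ler_norm _).
have e1 : expR (- t) <= 1 by rewrite -[leRHS](expR0 R) ler_expR oppr_le0 ltW.
have e2 : 0 <= 1 - expR (- t) by rewrite subr_ge0.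
exact: (gap_le e2 hA hB).
Qed.

End pair.

(** [tau] is the root mean square difference of the two regression functions,
    and both bounds are governed by its ratio to the noise level. *)
Lemma regression_tv_bounds A B (tau : R) : 0 < tau ->
  ((vec (A - B))^T *m Sigma *m vec (A - B)) 0 0 = tau ^+ 2 ->
  normal_box R ^+ 2 * (tau / sigma) / (1 + tau / sigma) <=
    tv (regression_law PX sigma A) (regression_law PX sigma B) <=
  12 * (tau / sigma) + 6 * (tau / sigma) ^+ 2.
Proof.
move=> tau0 tauE.
have tauE' : ((vec (B - A))^T *m Sigma *m vec (B - A)) 0 0 = tau ^+ 2.
  rewrite -(opprB A B) vecN -tauE.
  by rewrite mulmxN [(- _)^T]linearN /= !mulNmx opprK.
apply/andP; split.
  apply: le_trans (regression_tv_ge tau0 tauE).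
  set t := tau / sigma; have t0 : 0 < t by exact: divr_gt0.
  rewrite -mulrA ler_wpM2l ?sqr_ge0//.
  have h := expR_ge1Dx t.
  have -> : t / (1 + t) = 1 - (1 + t)^-1 by field; rewrite lt0r_neq0// addr_gt0.
  by rewrite lerD2l lerN2 expRN lef_pV2 ?posrE ?expR_gt0// addr_gt0.
apply: tv_le => E mE; apply: dist_le.
  exact: (regression_law_le_shift tau0 tauE mE).
exact: (regression_law_le_shift tau0 tauE' mE).
Qed.

End regression_tv.

(** * Packing by lattice points *)

(** The set [ball t] is meant as the ball of radius [t] of a norm: only the
    triangle inequality, homogeneity and a comparison with the sup norm are
    required, so that no norm has to be constructed. *)
Section lattice_packing.
Context (R : realType) (I : finType) (ball : R -> (I -> R) -> Prop) (K : R).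
Hypotheses (K0 : 0 <= K)
  (ballD : forall s t x y, ball s x -> ball t y -> ball (s + t) (x \+ y))
  (ballZ : forall s c x, ball s x -> ball (`|c| * s) (fun i => c * x i))
  (ball_le : forall s t x, s <= t -> ball s x -> ball t x)
  (ball_entry : forall t x i, ball t x -> `|x i| <= t)
  (cube_ball : forall x, (forall i, `|x i| <= 1) -> ball K x).

Let ballB s t x y : ball s x -> ball t y -> ball (s + t) (x \- y).
Proof.
move=> bx by_; have := ballD bx (ballZ (-1) by_); rewrite normrN1 mul1r.
by congr ball; apply/funext => i /=; rewrite mulN1r.
Qed.

Let toR (w : {ffun I -> int}) : I -> R := fun i => (w i)%:~R.

Let integer_points a : {s : seq {ffun I -> int} | forall w, ball a (toR w) <-> w \in s}.
Proof.
pose Z := (Num.truncn `|a|).+1.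
exists [seq w <- [seq [ffun i => (f i : nat)%:Z - Z%:Z] | f : {ffun I -> 'I_(2 * Z).+1}]
       | `[< ball a (toR w) >]].
move=> w; rewrite mem_filter; split => [bw|/andP[/asboolP]//].
apply/andP; split; first exact/asboolP.
have wZ i : `|w i| <= Z%:Z.
  have := ball_entry i bw; rewrite /toR -intr_norm => h.
  have h2 : (`|w i|)%:~R < Z%:~R :> R.
    apply: le_lt_trans h _; apply: (le_lt_trans (ler_norm a)).
    by rewrite -pmulrn; apply: real_truncnS_gt; exact: num_real.
  by rewrite ltW// -(ltr_int R).
apply/mapP; exists [ffun i => inord (absz (w i + Z%:Z))]; first by rewrite mem_enum.
apply/ffunP => i; rewrite !ffunE inordK.
  have := wZ i; rewrite ler_norml => /andP[h1 h2].
  by rewrite gez0_abs ?addrK//; lia.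
have := wZ i; rewrite ler_norml => /andP[h1 h2]; lia.
Qed.

(** Volume comparison without volumes: the lattice points of the scaled small
    balls around [q] separated points are pairwise distinct, and dividing by
    [b] with remainder sends them back to lattice points of one small ball, at
    most [b ^ #|I|] to one. *)
Lemma lattice_packing (q b : nat) (eta : R) (x : 'I_q -> I -> R) :
  0 < eta <= 1 -> 16 <= eta * b%:R ->
  (forall k, ball 1 (x k)) ->
  (forall k l, k != l -> ~ ball eta (x k \- x l)) ->
  (q <= b ^ #|I|)%N.
Proof.
move=> /andP[eta0 eta1] hb bx sep.
have [q0|q0] := posnP q; first by rewrite q0.
have b0 : 0 < b%:R :> R.
  by rewrite ltNge; apply/negP => b0; have := mulr_ge0_le0 (ltW eta0) b0; lra.
have b_gt0 : (0 < b)%N by rewrite -(ltr0n R).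
(* the mesh is fine enough for rounding errors to be negligible *)
pose N := (Num.truncn (16 * K / eta)).+1.
have N0 : 0 < N%:R :> R by rewrite ltr0n.
have NK : 16 * K <= N%:R * eta.
  rewrite -ler_pdivrMr// ltW//; apply: real_truncnS_gt; exact: num_real.
pose a : R := N%:R * eta / 4.
pose z k : {ffun I -> int} := [ffun i => Num.floor (N%:R * x k i)].
have zx k : ball K (fun i => toR (z k) i - N%:R * x k i).
  apply: cube_ball => i; rewrite /toR ffunE distrC.
  have h1 := floor_le_tmp (N%:R * x k i); have h2 := floorD1_gt (N%:R * x k i).
  rewrite intrD in h2; rewrite ger0_norm; lra.
have [S inS] := integer_points a.
have Sa (w : seq_sub S) : ball a (toR (ssval w)) by apply/inS; exact: (ssvalP w).
have zw k (w : seq_sub S) : ball (K + N%:R + a) (toR (z k + ssval w)).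
  have := ballD (ballD (zx k) (ballZ N%:R (bx k))) (Sa w).
  rewrite mulr1 ger0_norm ?ler0n//; congr ball; apply/funext => i.
  by rewrite /toR /= !ffunE intrD; lra.
pose quo k (w : seq_sub S) : {ffun I -> int} := [ffun i => ((z k + ssval w) i %/ b)%Z].
pose rem k (w : seq_sub S) i : int := ((z k + ssval w) i %% b)%Z.
have b_neq0 : (b : int) != 0 by rewrite -lt0n.
have rem_ge0 k w i : 0 <= rem k w i by exact: modz_ge0.
have rem_lt k w i : rem k w i < b by rewrite ltz_pmod.
have quoP k w : quo k w \in S.
  apply/inS; apply: (@ball_le (b%:R^-1 * (K + N%:R + a) + K)).
    have hb' : b%:R^-1 <= eta / 16.
      by rewrite -(@ler_pM2r _ b%:R)// mulVf ?gt_eqF// mulrAC ler_pdivlMr// mul1r.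
    have a0 : 0 <= K + N%:R + a.
      by rewrite /a !addr_ge0// ?mulr_ge0// ltW.
    apply: (@le_trans _ _ (eta / 16 * (K + N%:R + a) + K)).
      by rewrite lerD2r ler_wpM2r.
    have e1 : eta * K <= K by rewrite ler_piMl.
    have e2 : eta * (N%:R * eta) <= N%:R * eta by rewrite ler_piMl// mulr_ge0// ltW.
    rewrite /a; 
    have -> : eta / 16 * (K + N%:R + N%:R * eta / 4) =
      eta * K / 16 + N%:R * eta / 16 + eta * (N%:R * eta) / 64 by field.
    by have := K0; move: NK e1 e2; move: (N%:R * eta) (eta * K) (eta * _) => *; lra.
  have -> : toR (quo k w) = (fun i => b%:R^-1 * toR (z k + ssval w) i) \-
      (fun i => b%:R^-1 * (rem k w i)%:~R).
    apply/funext => i; rewrite /toR /= /quo /rem !ffunE.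
    set v := (_ + _ : int).
    rewrite [X in (b%:R^-1 * X - _)](_ : _ = (v %/ b)%Z%:~R * b%:R + (v %% b)%Z%:~R).
      by field; rewrite lt0r_neq0.
    by rewrite {1}(divz_eq v b) intrD intrM.
  apply: ballB.
    by have := ballZ b%:R^-1 (zw k w); rewrite ger0_norm// invr_ge0.
  apply: cube_ball => i; rewrite ger0_norm; last by rewrite mulr_ge0 ?invr_ge0 ?ler0n// ler0z.
  rewrite mulrC ler_pdivrMr// mul1r -[b%:R]/(b%:Z%:~R) ler_int.
  exact: ltW.
(* quotient and remainder determine [z k + w], hence [k] by separation *)
pose F (kw : 'I_q * seq_sub S) : {ffun I -> 'I_b.-1.+1} * seq_sub S :=
  ([ffun i => inord (absz (rem kw.1 kw.2 i))], SeqSub (quoP kw.1 kw.2)).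
have Finj : injective F.
  move=> [k w] [l w'] [/ffunP erem equo].
  have esum : z k + ssval w = z l + ssval w'.
    apply/ffunP => i; rewrite (divz_eq ((z k + ssval w) i) b) (divz_eq ((z l + ssval w') i) b).
    have /ffunP/(_ i) := equo; rewrite !ffunE => ->; congr (_ + _).
    have := erem i; rewrite !ffunE => /(congr1 val) /=.
    have lt u v : (absz (rem u v i) < b.-1.+1)%N.
      by rewrite prednK// -ltz_nat gez0_abs.
    rewrite !inordK// => /(congr1 Posz); rewrite !gez0_abs//.
    by rewrite /rem !ffunE.
  have [ekl|nkl] := eqVneq k l.
    move: esum; rewrite -ekl => /addrI /val_inj ->; by rewrite ekl.
  exfalso; apply: (sep k l nkl).
  have h1 := ballB (Sa w') (Sa w).
  have h2 := ballD h1 (ballB (zx l) (zx k)).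
  have := ballZ N%:R^-1 h2; rewrite ger0_norm ?invr_ge0 ?ler0n// => h3.
  apply: (@ball_le (N%:R^-1 * (a + a + (K + K)))).
    rewrite mulrC ler_pdivrMr// [leRHS]mulrC /a; have := K0; lra.
  move: h3; congr ball; apply/funext => i /=.
  have ei : toR (z k) i + toR (ssval w) i = toR (z l) i + toR (ssval w') i.
    by rewrite -!intrD; have /ffunP/(_ i) := esum; rewrite !ffunE => ->.
  have -> : N%:R^-1 * (toR (ssval w') i - toR (ssval w) i +
      (toR (z l) i - N%:R * x l i - (toR (z k) i - N%:R * x k i))) = x k i - x l i.
    have -> : toR (ssval w') i = toR (z k) i + toR (ssval w) i - toR (z l) i by lra.
    by field; rewrite lt0r_neq0.
  by [].
have := leq_card F Finj; rewrite !card_prod card_ord card_ffun card_ord prednK//.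
rewrite leq_pmul2r//; apply/card_gt0P.
have z0 : (0 : {ffun I -> int}) \in S.
  apply/inS; apply: (@ball_le K); first by rewrite /a; have := K0; lra.
  by apply: cube_ball => i; rewrite /toR ffunE normr0.
by exists (SeqSub z0).
Qed.
End lattice_packing.

(** * Packing of low-rank matrices *)

Section squared_frobenius.
Context (R : realType).

Definition frob2 (p q : nat) (X : 'M[R]_(p, q)) : R := \sum_i \sum_j X i j ^+ 2.

Section basics.
Context (p q : nat).
Implicit Types X Y : 'M[R]_(p, q).

Lemma frob2_ge0 X : 0 <= frob2 X.
Proof. by apply: sumr_ge0 => i _; apply: sumr_ge0 => j _; exact: sqr_ge0. Qed.

Lemma frobenius_sqr X : frobenius X ^+ 2 = frob2 X.
Proof. by rewrite sqr_sqrtr// frob2_ge0. Qed.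

Lemma frobenius_le X c : 0 <= c -> (frobenius X <= c) = (frob2 X <= c ^+ 2).
Proof.
by move=> c0; rewrite -frobenius_sqr ler_pXn2r// ?nnegrE ?sqrtr_ge0.
Qed.

Lemma frob2_entry X i j : X i j ^+ 2 <= frob2 X.
Proof.
rewrite /frob2 (bigD1 i)//= (bigD1 j)//= -addrA lerDl addr_ge0//.
  by apply: sumr_ge0 => l _; exact: sqr_ge0.
by apply: sumr_ge0 => h _; apply: sumr_ge0 => l _; exact: sqr_ge0.
Qed.

Lemma frob2_eq0 X : frob2 X = 0 -> X = 0.
Proof.
move=> X0; apply/matrixP => i j; rewrite mxE.
apply/eqP; rewrite -sqrf_eq0 eq_le sqr_ge0 andbT -X0; exact: frob2_entry.
Qed.

Lemma frob2_tr X : frob2 X = \tr (X^T *m X).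
Proof.
rewrite /frob2 exchange_big /mxtrace; apply: eq_bigr => j _.
by rewrite mxE; apply: eq_bigr => i _; rewrite mxE.
Qed.

Lemma frob2Z c X : frob2 (c *: X) = c ^+ 2 * frob2 X.
Proof.
rewrite /frob2 mulr_sumr; apply: eq_bigr => i _; rewrite mulr_sumr.
by apply: eq_bigr => j _; rewrite mxE exprMn.
Qed.

Lemma frob2_0 : frob2 (0 : 'M[R]_(p, q)) = 0.
Proof. by rewrite -(scale0r 0) frob2Z expr0n mul0r. Qed.

Lemma frob2D_orth X Y : X^T *m Y = 0 -> frob2 (X + Y) = frob2 X + frob2 Y.
Proof.
move=> XY; have YX : Y^T *m X = 0 by rewrite -[Y^T *m X]trmxK trmx_mul trmxK XY trmx0.
rewrite !frob2_tr [(X + Y)^T]raddfD /= mulmxDl !mulmxDr XY YX addr0 add0r.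
by rewrite raddfD.
Qed.

Lemma frob2_triangle X Y (s t : R) : 0 <= s -> 0 <= t ->
  frob2 X <= s ^+ 2 -> frob2 Y <= t ^+ 2 -> frob2 (X + Y) <= (s + t) ^+ 2.
Proof.
rewrite !le_eqVlt => /orP[/eqP<-|s0] /orP[/eqP<-|t0]; rewrite -!le_eqVlt.
- rewrite expr0n /= => X0 Y0.
  have -> : X = 0 by apply: frob2_eq0; apply/le_anti; rewrite X0 frob2_ge0.
  have -> : Y = 0 by apply: frob2_eq0; apply/le_anti; rewrite Y0 frob2_ge0.
  by rewrite addr0 frob2_0 sqr_ge0.
- rewrite expr0n /= add0r => X0 Yt.
  have -> : X = 0 by apply: frob2_eq0; apply/le_anti; rewrite X0 frob2_ge0.
  by rewrite add0r.
- rewrite expr0n /= addr0 => Xs Y0.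
  have -> : Y = 0 by apply: frob2_eq0; apply/le_anti; rewrite Y0 frob2_ge0.
  by rewrite addr0.
move=> Xs Yt.
have st : 0 < t / s by exact: divr_gt0.
have ts : 0 < s / t by exact: divr_gt0.
apply: (@le_trans _ _ ((1 + t / s) * frob2 X + (1 + s / t) * frob2 Y)).
  rewrite /frob2 !mulr_sumr -big_split /=; apply: ler_sum => i _.
  rewrite !mulr_sumr -big_split /=; apply: ler_sum => j _; rewrite mxE.
  set x := X i j; set y := Y i j.
  have : 0 <= (t * x - s * y) ^+ 2 / (s * t) by rewrite divr_ge0 ?sqr_ge0// mulr_ge0// ltW.
  have -> : (t * x - s * y) ^+ 2 / (s * t) =
      t / s * x ^+ 2 + s / t * y ^+ 2 - 2 * (x * y).
    by field; rewrite !lt0r_neq0.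
  rewrite !mulrDl !mul1r; lra.
have -> : (s + t) ^+ 2 = (1 + t / s) * s ^+ 2 + (1 + s / t) * t ^+ 2.
  by field; rewrite !lt0r_neq0.
by apply: lerD; rewrite ler_wpM2l// addr_ge0// ltW.
Qed.

End basics.

Lemma frob2_col_mx p1 p2 q (X : 'M[R]_(p1, q)) (Y : 'M[R]_(p2, q)) :
  frob2 (col_mx X Y) = frob2 X + frob2 Y.
Proof.
rewrite /frob2 big_split_ord /=; congr (_ + _); apply: eq_bigr => i _;
  by apply: eq_bigr => j _; rewrite ?col_mxEu ?col_mxEd.
Qed.

Lemma frobenius_eq0 p q (X : 'M[R]_(p, q)) : frobenius X = 0 -> X = 0.
Proof. by move=> h; apply: frob2_eq0; rewrite -frobenius_sqr h expr0n. Qed.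

Section unit_column.
Context (p : nat) (u : 'cV[R]_p).
Hypothesis u1 : u^T *m u = 1%:M.

Let K := 1%:M - u *m u^T.

Let uK : u^T *m K = 0.
Proof. by rewrite /K mulmxBr mulmx1 mulmxA u1 mul1mx subrr. Qed.

Let KT : K^T = K.
Proof. by rewrite /K linearB /= trmx1 trmx_mul trmxK. Qed.

Let KK : K *m K = K.
Proof. by rewrite {1}/K mulmxBl mul1mx -mulmxA uK mulmx0 subr0. Qed.

Lemma frob2_outer q (w : 'rV[R]_q) : frob2 (u *m w) = frob2 w.
Proof. by rewrite !frob2_tr trmx_mul -mulmxA (mulmxA u^T) u1 mul1mx. Qed.

Lemma frob2_project q (Z : 'M[R]_(p, q)) :
  frob2 Z = frob2 (u^T *m Z) + frob2 (K *m Z).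
Proof.
rewrite -(frob2_outer (u^T *m Z)) -frob2D_orth; last first.
  by rewrite !trmx_mul trmxK -!mulmxA (mulmxA u^T) uK mul0mx !mulmx0.
by congr frob2; rewrite /K mulmxBl mul1mx -mulmxA addrC subrK.
Qed.

Lemma frob2_peel q (w : 'rV[R]_q) (Z : 'M[R]_(p, q)) :
  frob2 (u *m w + K *m Z) <= frob2 w + frob2 Z.
Proof.
rewrite frob2D_orth; last by rewrite trmx_mul -mulmxA (mulmxA u^T) uK mul0mx mulmx0.
by rewrite frob2_outer lerD2l (frob2_project Z) lerDr frob2_ge0.
Qed.

Lemma rank_peel q (B : 'M[R]_(p, q)) : (u^T <= B^T)%MS ->
  (\rank (K *m B) < \rank B)%N.
Proof.
move=> uB; rewrite -mxrank_tr trmx_mul KT -[X in (_ < X)%N]mxrank_tr.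
rewrite -(mxrank_mul_ker B^T K) -[X in (X < _)%N]addn0 ltn_add2l.
have : (u^T <= B^T :&: kermx K)%MS.
  by rewrite sub_capmx uB; apply/sub_kermxP.
move/mxrankS; apply: leq_trans; rewrite lt0n mxrank_eq0.
apply: contra_eqN u1 => /eqP ->; rewrite mul0mx.
by rewrite eq_sym; apply/eqP/matrixP => /(_ 0 0); rewrite !mxE => /eqP; rewrite oner_eq0.
Qed.

Lemma peel_sum q (B : 'M[R]_(p, q)) : u *m (u^T *m B) + K *m (K *m B) = B.
Proof. by rewrite (mulmxA K) KK /K mulmxBl mul1mx mulmxA addrC subrK. Qed.

End unit_column.

(** A substitute for the singular value decomposition, obtained by splitting
    off the projection onto one column at a time. *)
Lemma low_rank_factor (p1 p2 k : nat) (B : 'M[R]_(p1, p2)) : (\rank B <= k)%N ->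
  exists (U : 'M[R]_(p1, k)) (V : 'M[R]_(k, p2)),
    [/\ B = U *m V, forall q (W : 'M[R]_(k, q)), frob2 (U *m W) <= frob2 W &
        frob2 V <= frob2 B].
Proof.
elim: k B => [|k IH] B rB.
  exists 0, 0; split.
  - by move: rB; rewrite leqn0 mxrank_eq0 mul0mx => /eqP.
  - by move=> q W; rewrite mul0mx frob2_0 frob2_ge0.
  - by rewrite frob2_0 frob2_ge0.
have [->|B0] := eqVneq B 0.
  exists 0, 0; split; rewrite ?mul0mx ?frob2_0// => q W.
  by rewrite mul0mx frob2_0 frob2_ge0.
have [j colj] : exists j, col j B != 0.
  apply/existsP; apply: contraR B0; rewrite negb_exists => /forallP h.
  apply/eqP/matrixP => i j; rewrite mxE.
  by have /negPn/eqP/colP/(_ i) := h j; rewrite !mxE.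
have f0 : 0 < frob2 (col j B).
  rewrite lt_def frob2_ge0 andbT; apply: contra_neq colj; exact: frob2_eq0.
pose c := (Num.sqrt (frob2 (col j B)))^-1.
pose u := c *: col j B.
have u1 : u^T *m u = 1%:M.
  apply/matrixP => i l; rewrite !ord1 [RHS]mxE eqxx.
  have := frob2_tr u; rewrite /mxtrace big_ord1 => <-.
  rewrite frob2Z /c exprVn sqr_sqrtr ?frob2_ge0// mulVf//; exact: lt0r_neq0.
have uB : (u^T <= B^T)%MS.
  by rewrite /u linearZ /= scalemx_sub// tr_col row_sub.
have /IH[U' [V' [EB hU hV]]] : (\rank ((1%:M - u *m u^T) *m B) <= k)%N.
  by rewrite -ltnS; apply: leq_trans (rank_peel u1 uB) rB.
exists (row_mx u ((1%:M - u *m u^T) *m U')), (col_mx (u^T *m B) V'); split.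
- by rewrite (@mul_row_col _ _ 1 k) -mulmxA -EB peel_sum.
- move=> q W; rewrite -(@vsubmxK _ 1 k _ W) (@mul_row_col _ _ 1 k) -mulmxA.
  apply: le_trans (frob2_peel u1 _ _) _.
  by rewrite (@frob2_col_mx 1 k) lerD2l.
- by rewrite (@frob2_col_mx 1 k) (frob2_project u1 B) lerD2l.
Qed.

End squared_frobenius.

Section factor_ball.
Context (R : realType) (p1 p2 k : nat).
Hypothesis p2_gt0 : (0 < p2)%N.

Let I := ('I_p1 * 'I_k + 'I_k * 'I_p2)%type.
Implicit Types x y : I -> R.

Let left_mx x : 'M[R]_(p1, k) := \matrix_(i, j) x (inl (i, j)).
Let right_mx x : 'M[R]_(k, p2) := \matrix_(i, j) x (inr (i, j)).

(** The ball of radius [t] for the larger of the operator norm of the left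
    factor and the Frobenius norm of the right one. *)
Let factor_ball (t : R) x : Prop := [/\ 0 <= t,
  forall W : 'M[R]_(k, p2), frob2 (left_mx x *m W) <= t ^+ 2 * frob2 W &
  frob2 (right_mx x) <= t ^+ 2].

(** A crude radius of a ball that contains the unit cube; the lattice mesh is
    chosen in terms of it. *)
Let K : R := (p1 * p2 * k + k * p2)%:R.

Let factor_ballD s t x y : factor_ball s x -> factor_ball t y ->
  factor_ball (s + t) (x \+ y).
Proof.
move=> [s0 xl xr] [t0 yl yr]; split; first exact: addr_ge0.
  move=> W; have -> : left_mx (x \+ y) = left_mx x + left_mx y.
    by apply/matrixP => i j; rewrite !mxE.
  rewrite mulmxDl -(sqr_sqrtr (frob2_ge0 W)) -exprMn mulrDl.
  by apply: frob2_triangle; rewrite ?mulr_ge0 ?sqrtr_ge0// exprMn sqr_sqrtr// frob2_ge0.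
have -> : right_mx (x \+ y) = right_mx x + right_mx y.
  by apply/matrixP => i j; rewrite !mxE.
exact: frob2_triangle.
Qed.

Let factor_ballZ s c x : factor_ball s x -> factor_ball (`|c| * s) (fun i => c * x i).
Proof.
move=> [s0 xl xr]; split; first by rewrite mulr_ge0.
  move=> W; have -> : left_mx (fun i => c * x i) = c *: left_mx x.
    by apply/matrixP => i j; rewrite !mxE.
  by rewrite -scalemxAl frob2Z exprMn real_normK ?num_real// -[leRHS]mulrA ler_wpM2l ?sqr_ge0.
have -> : right_mx (fun i => c * x i) = c *: right_mx x.
  by apply/matrixP => i j; rewrite !mxE.
by rewrite frob2Z exprMn real_normK ?num_real// ler_wpM2l ?sqr_ge0.
Qed.

Let factor_ball_le s t x : s <= t -> factor_ball s x -> factor_ball t x.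
Proof.
move=> st [s0 xl xr]; have t0 := le_trans s0 st.
have st2 : s ^+ 2 <= t ^+ 2 by rewrite lerXn2r ?nnegrE.
split => //; last exact: le_trans st2.
by move=> W; apply: (le_trans (xl W)); rewrite ler_wpM2r ?frob2_ge0.
Qed.

Let factor_ball_entry t x i : factor_ball t x -> `|x i| <= t.
Proof.
move=> [t0 xl xr].
suff : x i ^+ 2 <= t ^+ 2.
  by rewrite -[_ ^+ 2]real_normK ?num_real// ler_pXn2r// ?nnegrE.
case: i => [[i j]|[i j]].
  pose z : 'I_p2 := Ordinal p2_gt0.
  have d1 : frob2 (delta_mx j z : 'M[R]_(k, p2)) = 1.
    rewrite /frob2 (bigD1 j)//= (bigD1 z)//= !big1 ?addr0.
    - by rewrite mxE !eqxx expr1n.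
    - by move=> l jl; rewrite big1// => h _; rewrite mxE (negbTE jl) expr0n.
    - by move=> h zh; rewrite mxE eqxx (negbTE zh) expr0n.
  have := xl (delta_mx j z); rewrite d1 mulr1; apply: le_trans.
  apply: le_trans (frob2_entry _ i z).
  rewrite [X in _ <= X ^+ 2]mxE (bigD1 j)//= big1 ?addr0.
    by rewrite !mxE !eqxx mulr1.
  by move=> l jl; rewrite !mxE (negbTE jl) mulr0.
apply: le_trans xr; have := frob2_entry (right_mx x) i j.
by rewrite mxE.
Qed.

Let frob2_le_bound p q (X : 'M[R]_(p, q)) (c : R) :
  (forall i j, X i j ^+ 2 <= c) -> frob2 X <= (p * q)%:R * c.
Proof.
move=> h; apply: (@le_trans _ _ (\sum_(i < p) \sum_(j < q) c)).
  by apply: ler_sum => i _; apply: ler_sum.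
by rewrite !sumr_const !card_ord -mulrnA mulnC mulr_natl.
Qed.

Let cube_factor_ball x : (forall i, `|x i| <= 1) -> factor_ball K x.
Proof.
move=> x1; split; first exact: ler0n.
  move=> W; pose f := Num.sqrt (frob2 W).
  have f0 : 0 <= f by exact: sqrtr_ge0.
  have Wf l j : `|W l j| <= f.
    by rewrite -sqrtr_sqr ler_wsqrtr// frob2_entry.
  apply: (@le_trans _ _ ((p1 * p2)%:R * (k%:R * f) ^+ 2)).
    apply: frob2_le_bound => i j.
    rewrite -[_ ^+ 2]real_normK ?num_real// lerXn2r ?nnegrE ?mulr_ge0//.
    rewrite mxE; apply: (le_trans (ler_norm_sum _ _ _)).
    apply: (@le_trans _ _ (\sum_(l < k) f)).
      apply: ler_sum => l _; rewrite normrM mxE -[leRHS]mul1r.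
      by apply: ler_pM.
    by rewrite sumr_const card_ord mulr_natl.
  rewrite exprMn sqr_sqrtr ?frob2_ge0// mulrA ler_wpM2r ?frob2_ge0//.
  rewrite /K -!natrX -natrM ler_nat; nia.
apply: (@le_trans _ _ ((k * p2)%:R * 1)).
  apply: frob2_le_bound => i j; rewrite mxE.
  by rewrite -[_ ^+ 2]real_normK ?num_real// exprn_ile1.
rewrite mulr1 /K -natrX ler_nat; nia.
Qed.

(** Two matrices whose factors are close are close:
    [U1 V1 - U2 V2 = U1 (V1 - V2) + (U1 - U2) V2]. *)
Lemma low_rank_packing (q b : nat) (B : 'I_q -> 'M[R]_(p1, p2)) (rad s : R) :
  0 < s <= 2 * rad -> 32 * rad <= s * b%:R ->
  (forall i, \rank (B i) <= k)%N -> (forall i, frob2 (B i) <= rad ^+ 2) ->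
  (forall i j, i != j -> s ^+ 2 < frob2 (B i - B j)) ->
  (q <= b ^ (p1 * k + k * p2))%N.
Proof.
move=> /andP[s0 srad] hb rB fB sep.
have rad0 : 0 < rad by lra.
have /choice[U /choice[V UV]] i := low_rank_factor (rB i).
pose x i : I -> R := fun h => match h with
  | inl (a, c) => U i a c | inr (a, c) => rad^-1 * V i a c end.
have xl i : left_mx (x i) = U i by apply/matrixP => a c; rewrite !mxE.
have xr i : right_mx (x i) = rad^-1 *: V i.
  by apply/matrixP => a c; rewrite !mxE.
have := @lattice_packing R I factor_ball K (ler0n _ _) factor_ballD factor_ballZ
  factor_ball_le factor_ball_entry cube_factor_ball q b (s / (2 * rad)) x.
rewrite card_sum !card_prod !card_ord; apply.
- by rewrite divr_gt0 ?mulr_gt0//= ler_pdivrMr ?mulr_gt0// mul1r.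
- rewrite mulrAC ler_pdivlMr ?mulr_gt0//; lra.
- move=> i; have [_ hU hV] := UV i; split => //; first by move=> W; rewrite xl expr1n mul1r.
  rewrite xr frob2Z expr1n exprVn mulrC ler_pdivrMr ?exprn_gt0// mul1r.
  exact: le_trans hV (fB i).
move=> i j ij [_ hl hr]; have := sep i j ij; apply/negP; rewrite -leNgt.
have [Bi hU _] := UV i; have [Bj _ hVj] := UV j.
have -> : B i - B j = U i *m (V i - V j) + (U i - U j) *m V j.
  by rewrite mulmxBr mulmxBl addrA subrK -Bi -Bj.
have -> : s ^+ 2 = (s / 2 + s / 2) ^+ 2 by congr (_ ^+ 2); field.
apply: frob2_triangle; rewrite ?divr_ge0// ?(ltW s0)//.
  apply: (le_trans (hU _ _)).
  move: hr; rewrite (_ : right_mx _ = rad^-1 *: (V i - V j)); last first.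
    by apply/matrixP => a c; rewrite !mxE mulrBr.
  rewrite frob2Z exprVn mulrC ler_pdivrMr ?exprn_gt0// => /le_trans; apply.
  rewrite -exprMn le_eqVlt; apply/orP; left; apply/eqP; congr (_ ^+ 2).
  by field; rewrite lt0r_neq0.
have := hl (V j); rewrite (_ : left_mx _ = U i - U j); last first.
  by apply/matrixP => a c; rewrite !mxE.
move=> /le_trans; apply.
apply: (@le_trans _ _ ((s / (2 * rad)) ^+ 2 * rad ^+ 2)).
  by rewrite ler_wpM2l ?sqr_ge0// (le_trans hVj).
rewrite -exprMn le_eqVlt; apply/orP; left; apply/eqP; congr (_ ^+ 2).
by field; rewrite lt0r_neq0.
Qed.

End factor_ball.

(** * Minimal covers *)

Section maximal_separated.
Context (T : Type) (sep : T -> T -> Prop) (S : set T) (N : nat).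
Hypothesis sep_card : forall (q : nat) (f : 'I_q -> T),
  (forall i, S (f i)) -> (forall i j, i != j -> sep (f i) (f j)) -> (q <= N)%N.
Hypothesis sep_sym : forall x y, sep x y -> sep y x.

Lemma maximal_separated : exists (q : nat) (f : 'I_q -> T),
  [/\ (q <= N)%N, forall i, S (f i) & forall x, S x -> exists i, ~ sep (f i) x].
Proof.
pose P q := `[< exists f : 'I_q -> T, (forall i, S (f i)) /\ (forall i j, i != j -> sep (f i) (f j)) >].
have P0 : exists q, P q.
  exists 0%N; apply/asboolP.
  have f : 'I_0 -> T by case.
  by exists f; split; case.
have Pub q : P q -> (q <= N)%N by move=> /asboolP[f [Sf sf]]; exact: (sep_card Sf sf).
have [q /asboolP[f [Sf sf]] qmax] := ex_maxnP P0 Pub.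
exists q, f; split => //; first exact: (sep_card Sf sf).
move=> x Sx; apply: contrapT => /forallNP h.
suff /qmax : P q.+1 by rewrite ltnn.
apply/asboolP; exists (fun i => if unlift ord0 i is Some j then f j else x).
split=> [i|i j]; first by case: unliftP => [l _|_].
case: unliftP => [l ->|->]; case: unliftP => [l' ->|->] //.
- by move=> ll; apply: sf; apply: contra_neq ll => ->.
- by move=> _; apply: contrapT; exact: h.
- by move=> _; apply: sep_sym; apply: contrapT; exact: h.
Qed.

End maximal_separated.

Section minimal_cover.
Context (R : realType) (d : measure_display) (T : measurableType d)
  (Theta : Type) (P : Theta -> probability T R) (delta : R) (S : set Theta)
  (m : nat) (a : 'I_m -> Theta).
Hypothesis min_cover : is_minimal_cover P delta S a.

(** The cover points of [A] could be exchanged for any other cover of the part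
    of [S] that they serve, so minimality bounds their number. *)
Lemma minimal_cover_local (A : pred 'I_m) (q : nat) (f : 'I_q -> Theta) :
  (forall i, S (f i)) ->
  (forall j t, A j -> S t -> tv (P (a j)) (P t) <= delta ->
     exists i, tv (P (f i)) (P t) <= delta) ->
  (#|A| <= q)%N.
Proof.
move=> Sf cov; have [[Sa ca] mmin] := min_cover.
pose n' := #|[predC A]|.
pose g (i : 'I_(n' + q)) : Theta :=
  match fintype.split i with inl l => a (enum_val l) | inr l => f l end.
have : is_cover P delta S g.
  split; first by move=> i; rewrite /g; case: fintype.split.
  move=> t St; have [j hj] := ca t St.
  have [Aj|nAj] := boolP (j \in A).
    have [i hi] := cov j t Aj St hj.
    by exists (unsplit (inr i)); rewrite /g unsplitK.
  have jC : j \in [predC A] by [].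
  exists (unsplit (inl (enum_rank_in jC j))).
  by rewrite /g unsplitK enum_rankK_in.
move=> /mmin; rewrite /n' -{1}(card_ord m) -(cardC A) addnC leq_add2l.
exact.
Qed.

End minimal_cover.

(** * From total variation to Frobenius norm *)

Section low_rank_model.
Context (R : realType) (p1 p2 r : nat) (d : measure_display)
  (T : measurableType d) (P : 'M[R]_(p1, p2) -> probability T R)
  (S : set 'M[R]_(p1, p2)) (cL cU g : R).
Hypotheses (p2_gt0 : (0 < p2)%N) (cL0 : 0 < cL) (cLU : cL <= cU) (g0 : 0 < g)
  (rankS : forall A, S A -> (\rank A <= r)%N)
  (tvL : forall A B, S A -> S B -> cL * (g * frobenius (A - B)) <= tv (P A) (P B))
  (tvU : forall A B, S A -> S B -> tv (P A) (P B) <= cU * (g * frobenius (A - B))).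

(** Local metric entropy of order [r * (p1 + p2)]: separated points of a ball
    of radius [l * delta] differ by matrices of rank at most [2 * r]. *)
Lemma minimal_cover_local_card (delta : R) (m : nat)
    (a : 'I_m -> 'M[R]_(p1, p2)) (A : 'M[R]_(p1, p2)) (l : nat) :
  0 < delta -> is_minimal_cover P delta S a -> S A -> (0 < l)%N ->
  #|[pred j | tv (P A) (P (a j)) <= l%:R * delta]|%:R <=
    expR (128 * (cU / cL) * (r * (p1 + p2))%:R * l%:R).
Proof.
move=> delta0 mc SA l0.
have cU0 : 0 < cU by exact: lt_le_trans cLU.
pose rad := (l%:R + 1) * delta / (cL * g).
pose s := delta / (cU * g).
have s0 : 0 < s by rewrite divr_gt0// mulr_gt0.
have lR : 1 <= l%:R :> R by rewrite (ler_nat R 1 l).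
have rad0 : 0 < rad.
  by rewrite divr_gt0 ?mulr_gt0// addr_gt0// ltr0n.
have rad_s : rad = (l%:R + 1) * (cU / cL) * s.
  by rewrite /rad /s; field; rewrite !lt0r_neq0.
have ratio1 : 1 <= cU / cL by rewrite ler_pdivlMr// mul1r.
pose b := (Num.truncn (64 * (cU / cL) * l%:R)).+1.
have b_gt : 64 * (cU / cL) * l%:R < b%:R.
  by apply: real_truncnS_gt; exact: num_real.
have b_le : b%:R <= expR (64 * (cU / cL) * l%:R).
  apply: le_trans (expR_ge1Dx _); rewrite /b -natr1 addrC lerD2l truncn_le.
  by apply: mulr_ge0 => //; apply: mulr_ge0 => //; lra.
pose near_A : set 'M[R]_(p1, p2) := [set B | S B /\ frob2 (B - A) <= rad ^+ 2].
pose sep (B C : 'M[R]_(p1, p2)) : Prop := s ^+ 2 < frob2 (B - C).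
have sep_card q (f : 'I_q -> 'M[R]_(p1, p2)) : (forall i, near_A (f i)) ->
    (forall i j, i != j -> sep (f i) (f j)) ->
    (q <= b ^ (p1 * (2 * r) + (2 * r) * p2))%N.
  move=> Nf sf; apply: (@low_rank_packing _ _ _ _ p2_gt0 q b (fun i => f i - A) rad s).
  - rewrite s0 /= rad_s.
    have : 1 * 1 <= (l%:R + 1) * (cU / cL) by apply: ler_pM => //; lra.
    by move=> h; have := ler_wpM2r (ltW s0) h; lra.
  - rewrite rad_s mulrA [leRHS]mulrC ler_wpM2r ?(ltW s0)//.
    have := ler_wpM2l (_ : 0 <= cU / cL) lR.
    by move=> /(_ ltac:(lra)) h; lra.
  - move=> i; rewrite mul2n -addnn; apply: leq_trans (mxrank_add _ _) _.
    by rewrite mxrank_opp leq_add ?rankS//; case: (Nf i).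
  - by move=> i; case: (Nf i).
  - move=> i j ij; rewrite opprB addrA subrK; exact: sf.
have sep_sym B C : sep B C -> sep C B.
  by rewrite /sep -(opprB C B) -scaleN1r frob2Z sqrrN expr1n mul1r.
have [q [f [qle Nf cov]]] := maximal_separated sep_card sep_sym.
apply: (@le_trans _ _ (b ^ (p1 * (2 * r) + (2 * r) * p2))%:R).
  rewrite ler_nat; apply: leq_trans qle.
  apply: (minimal_cover_local mc (f := f)); first by move=> i; case: (Nf i).
  move=> j B; rewrite inE => Aj SB jB.
  have [[Sa _] _] := mc.
  have NB : near_A B.
    split => //; have AB : tv (P A) (P B) <= (l%:R + 1) * delta.
      have := tv_triangle (P A) (P (a j)) (P B); lra.
    have := le_trans (tvL SB SA) (_ : tv (P B) (P A) <= (l%:R + 1) * delta).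
    rewrite (tv_sym (P B)) => /(_ AB) h.
    rewrite -frobenius_le ?(ltW rad0)//.
    by rewrite /rad ler_pdivlMr ?mulr_gt0// mulrC -mulrA.
  have [i /negP hi] := cov B NB; exists i.
  rewrite -leNgt in hi; have [Sfi _] := Nf i.
  apply: (le_trans (tvU Sfi SB)).
  have fs : frobenius (f i - B) <= s.
    by rewrite frobenius_le// ltW.
  by rewrite mulrA -[leRHS](@divfK _ (cU * g)) ?mulf_neq0 ?lt0r_neq0// [leRHS]mulrC ler_wpM2l ?mulr_ge0// ltW.
rewrite natrX.
have -> : (p1 * (2 * r) + 2 * r * p2 = 2 * (r * (p1 + p2)))%N.
  by rewrite mulnCA -mulnA -mulnDr (mulnC p1) -mulnDr.
apply: (@le_trans _ _ (expR (64 * (cU / cL) * l%:R) ^+ (2 * (r * (p1 + p2))))).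
  by rewrite lerXn2r ?nnegrE ?expR_ge0.
by rewrite -expRM_natl ler_expR natrM; lra.
Qed.

End low_rank_model.

Section restricted_eigenvalues.
Context (R : realType) (p1 p2 s : nat) (Sigma : 'M[R]_(p1 * p2)) (kappa kappa_u : R).
Hypotheses (kappa0 : 0 < kappa)
  (lower : (kappa%:E <= ereal_inf (restricted_ratios s Sigma))%E)
  (upper : (ereal_sup (restricted_ratios s Sigma) <= kappa_u%:E)%E).

Lemma frobenius_gt0 (A : 'M[R]_(p1, p2)) : A != 0 -> 0 < frobenius A.
Proof.
move=> A0; rewrite lt_def sqrtr_ge0 andbT; apply: contra_neq A0.
exact: frobenius_eq0.
Qed.

Lemma restricted_ratio (A : 'M[R]_(p1, p2)) : A != 0 -> (\rank A <= s)%N ->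
  kappa * frobenius A <= l2norm (sqrtmx Sigma *m vec A) <= kappa_u * frobenius A.
Proof.
move=> A0 rA; have f0 := frobenius_gt0 A0.
have inR : restricted_ratios s Sigma
    (l2norm (sqrtmx Sigma *m vec A) / frobenius A)%:E by exists A.
have := le_trans lower (ereal_inf_lbound inR).
have := le_trans (ereal_sup_ubound inR) upper.
by rewrite !lee_fin ler_pdivlMr// ler_pdivrMr// => -> ->.
Qed.

(** A positive lower restricted eigenvalue is only possible when the square
    root in its definition is a genuine one. *)
Lemma sqrtmx_root (A : 'M[R]_(p1, p2)) : A != 0 -> (\rank A <= s)%N ->
  covariance_mx (sqrtmx Sigma) /\ sqrtmx Sigma *m sqrtmx Sigma = Sigma.
Proof.
move=> A0 rA; have /andP[h _] := restricted_ratio A0 rA.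
move: h; rewrite /sqrtmx; case: xgetP => [T _ //|_].
rewrite mul0mx /l2norm big1 ?sqrtr0 => [|i _]; last by rewrite mxE expr0n.
by rewrite leNgt mulr_gt0// frobenius_gt0.
Qed.

Lemma quadratic_form_sqr (A : 'M[R]_(p1, p2)) : A != 0 -> (\rank A <= s)%N ->
  ((vec A)^T *m Sigma *m vec A) 0 0 = l2norm (sqrtmx Sigma *m vec A) ^+ 2.
Proof.
move=> A0 rA; have [[sym _] sq] := sqrtmx_root A0 rA.
rewrite sqr_sqrtr; last by apply: sumr_ge0 => i _; exact: sqr_ge0.
rewrite -{1}sq -{1}sym !mulmxA -trmx_mul -mulmxA [LHS]mxE.
by apply: eq_bigr => i _; rewrite mxE.
Qed.

End restricted_eigenvalues.

Lemma linear_le_saturated (R : realType) (q T0 t x : R) :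
  0 <= q -> 0 <= x -> 0 < t -> x <= t -> t <= T0 ->
  q / (1 + T0) * x <= q * t / (1 + t).
Proof.
move=> q0 x0 t0 xt tT; rewrite -!mulrA ler_wpM2l// mulrC.
apply: ler_pM => //; first by rewrite invr_ge0; lra.
by rewrite lef_pV2 ?posrE ?lerD2l//; lra.
Qed.

Lemma quadratic_le_linear (R : realType) (c k2 T0 t x : R) :
  0 <= x -> 0 < t -> 0 <= c -> t <= k2 * x -> t <= T0 ->
  12 * t + 6 * t ^+ 2 <= (c + (12 + 6 * T0) * k2) * x.
Proof.
move=> x0 t0 c0 tx tT; apply: (@le_trans _ _ ((12 + 6 * T0) * t)).
  have := ler_wpM2r (ltW t0) tT; rewrite expr2; lra.
apply: (@le_trans _ _ ((12 + 6 * T0) * (k2 * x))).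
  by rewrite ler_wpM2l//; lra.
by rewrite [leRHS]mulrDl mulrA lerDr mulr_ge0.
Qed.

(** Total variation in the model is the normalized Frobenius distance up to
    constants, because [tau / sigma] stays bounded on the parameter set. *)
Lemma regression_model_tv (R : realType) (M k2 : R) : 0 < M -> 0 < k2 ->
  exists cL cU : R, [/\ 0 < cL, cL <= cU &
  forall (r p1 p2 : nat) (sigma kappa kappa_u : R)
    (Sigma : 'M[R]_(p1 * p2)) (PX : probability 'M[R]_(p1, p2) R),
  0 < sigma -> 0 < kappa -> kappa_u <= k2 * kappa ->
  (kappa%:E <= ereal_inf (restricted_ratios (2 * r) Sigma))%E ->
  (ereal_sup (restricted_ratios (2 * r) Sigma) <= kappa_u%:E)%E ->
  gaussian_mx Sigma PX ->
  forall A B, param_set r M sigma kappa A -> param_set r M sigma kappa B ->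
  cL * (kappa / sigma * frobenius (A - B)) <=
    tv (regression_model PX sigma A) (regression_model PX sigma B) /\
  tv (regression_model PX sigma A) (regression_model PX sigma B) <=
    cU * (kappa / sigma * frobenius (A - B))].
Proof.
move=> M0 k20; pose T0 := 2 * M * k2.
have T00 : 0 < T0 by rewrite !mulr_gt0.
have box0 := normal_box_gt0 R.
pose cL := normal_box R ^+ 2 / (1 + T0).
have cL0 : 0 < cL by rewrite divr_gt0 ?exprn_gt0// addr_gt0.
exists cL, (cL + (12 + 6 * T0) * k2); split => //.
  by rewrite lerDl mulr_ge0 ?(ltW k20)// addr_ge0// mulr_ge0// ltW.
move=> r p1 p2 sigma kappa kappa_u Sigma PX sigma0 kappa0 hk lo up gPX
  A B [rA fA] [rB fB].
have [->|AB] := eqVneq A B.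
  rewrite tv_id subrr /frobenius big1 ?sqrtr0 ?mulr0// => i _.
  by rewrite big1// => j _; rewrite mxE expr0n.
have C0 : A - B != 0 by rewrite subr_eq0.
have rC : (\rank (A - B)%R <= 2 * r)%N.
  rewrite mul2n -addnn; apply: leq_trans (mxrank_add _ _) _.
  by rewrite mxrank_opp leq_add.
have f0 := frobenius_gt0 C0.
have /andP[t1 t2] := restricted_ratio lo up C0 rC.
have tE := quadratic_form_sqr kappa0 lo up C0 rC.
move: t1 t2 tE; set tau := l2norm _ => t1 t2 tE.
have tau0 : 0 < tau by apply: lt_le_trans t1; rewrite mulr_gt0.
have /andP[h1 h2] := regression_tv_bounds gPX sigma0 tau0 tE.
have fAB : frobenius (A - B) <= M * sigma / kappa + M * sigma / kappa.
  have Msk : 0 <= M * sigma / kappa by rewrite divr_ge0 ?mulr_ge0// ltW.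
  rewrite frobenius_le ?addr_ge0//.
  apply: frob2_triangle; rewrite -?frobenius_le//.
  by rewrite -scaleN1r frobenius_le// frob2Z sqrrN expr1n mul1r -frobenius_le.
set f := frobenius (A - B) in t1 t2 f0 fAB *.
have [tl [tu tT]] : kappa / sigma * f <= tau / sigma /\
    (tau / sigma <= k2 * (kappa / sigma * f) /\ tau / sigma <= T0).
  have e1 : kappa / sigma * f = kappa * f / sigma by rewrite mulrAC.
  have e2 : tau / sigma <= k2 * (kappa / sigma * f).
    rewrite e1 mulrA ler_pM2r ?invr_gt0// mulrA (le_trans t2)//.
    by rewrite ler_pM2r.
  split; first by rewrite e1 ler_pM2r ?invr_gt0.
  split => //; apply: (le_trans e2).
  rewrite /T0 [leRHS]mulrC ler_pM2l// mulrC -ler_pdivlMr ?divr_gt0//.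
  apply: (le_trans fAB); rewrite le_eqVlt; apply/orP; left; apply/eqP.
  by field; rewrite !lt0r_neq0.
have t0 : 0 < tau / sigma by exact: divr_gt0.
have X0 : 0 <= kappa / sigma * f by rewrite mulr_ge0 ?divr_ge0// ltW.
have q0 : 0 <= normal_box R ^+ 2 by exact: sqr_ge0.
split.
  exact: le_trans (linear_le_saturated q0 X0 t0 tl tT) h1.
exact: le_trans h2 (quadratic_le_linear X0 t0 (ltW cL0) tu tT).
Qed.

(** The last step: a distance of order [delta + eps] in total variation, squared
    and rescaled by [g = kappa / sigma]. *)
Lemma frobenius_risk (R : realType) (f g cL K delta eps d2 x v : R) :
  0 < cL -> 0 < g -> 0 <= f -> 0 <= delta -> 0 <= eps -> 0 <= K -> 0 <= x ->
  delta <= d2 * Num.sqrt x ->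
  cL * (g * f) <= v -> v <= K * (delta + eps) ->
  f ^+ 2 <= 2 * (K / cL) ^+ 2 * (d2 ^+ 2 + 1) * (g ^+ 2)^-1 * Num.max x (eps ^+ 2).
Proof.
move=> cL0 g0 f0 delta0 eps0 K0 x0 hdelta h1 h2.
have cg0 : 0 < cL * g by exact: mulr_gt0.
have fle : f <= K / cL / g * (delta + eps).
  rewrite -(ler_pM2l cg0); apply: (@le_trans _ _ (K * (delta + eps))).
    by rewrite -[leLHS]mulrA (le_trans h1).
  rewrite le_eqVlt; apply/orP; left; apply/eqP.
  by field; rewrite !lt0r_neq0.
set y := Num.max _ _.
have yx : x <= y by rewrite le_max lexx.
have ye : eps ^+ 2 <= y by rewrite le_max lexx orbT.
have d2x : delta ^+ 2 <= d2 ^+ 2 * y.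
  apply: (@le_trans _ _ ((d2 * Num.sqrt x) ^+ 2)).
    by rewrite lerXn2r ?nnegrE// (le_trans delta0).
  by rewrite exprMn sqr_sqrtr// ler_wpM2l ?sqr_ge0.
apply: (@le_trans _ _ ((K / cL / g * (delta + eps)) ^+ 2)).
  by rewrite lerXn2r ?nnegrE// (le_trans f0).
have -> : (K / cL / g * (delta + eps)) ^+ 2 =
    (K / cL) ^+ 2 * (g ^+ 2)^-1 * (delta + eps) ^+ 2 by rewrite -exprVn; ring.
have -> : 2 * (K / cL) ^+ 2 * (d2 ^+ 2 + 1) * (g ^+ 2)^-1 * y =
  (K / cL) ^+ 2 * (g ^+ 2)^-1 * (2 * ((d2 ^+ 2 + 1) * y)) by ring.
apply: ler_wpM2l; first by rewrite mulr_ge0 ?invr_ge0 ?sqr_ge0.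
have := sqr_ge0 (delta - eps); rewrite mulrDl mul1r; nra.
Qed.

Theorem corollary4p3 (R : realType) (M k1 k2 d1 d2 : R)
    (hM : 0 < M) (hk1 : 0 < k1) (hk12 : k1 <= k2)
    (hd1 : 0 < d1) (hd12 : d1 <= d2) :
  exists c C C' : R, [/\ 0 < c, 0 < C, 0 < C' &
  forall (n r p1 p2 : nat) (sigma kappa kappa_u delta : R)
    (Sigma : 'M[R]_(p1 * p2)) (PX : probability 'M[R]_(p1, p2) R),
  (0 < r)%N -> (0 < p1)%N -> (0 < p2)%N ->
  0 < sigma -> 0 < kappa -> 0 < kappa_u ->
  k1 * kappa <= kappa_u <= k2 * kappa ->
  covariance_mx Sigma ->
  (kappa%:E <= ereal_inf (restricted_ratios (2 * r) Sigma))%E ->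
  (ereal_inf (restricted_ratios (2 * r) Sigma) <=
   ereal_sup (restricted_ratios (2 * r) Sigma))%E ->
  (ereal_sup (restricted_ratios (2 * r) Sigma) <= kappa_u%:E)%E ->
  gaussian_mx Sigma PX ->
  (r * (p1 + p2))%:R <= c * n%:R ->
  d1 * Num.sqrt ((r * (p1 + p2))%:R / n%:R) <= delta
    <= d2 * Num.sqrt ((r * (p1 + p2))%:R / n%:R) ->
  let calA := @param_set R p1 p2 r M sigma kappa in
  let P := regression_model PX sigma in
  forall (m : nat) (cover : 'I_m -> 'M[R]_(p1, p2))
    (mu : {measure set (obs R p1 p2) -> \bar R})
    (p : 'M[R]_(p1, p2) -> obs R p1 p2 -> R)
    (Ahat : ('I_n -> obs R p1 p2) -> 'M[R]_(p1, p2)),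
  is_minimal_cover P delta calA cover ->
  (forall A, calA A -> is_density mu (P A) (p A)) ->
  (forall z, tournament_winner P p cover z (Ahat z)) ->
  forall (A : 'M[R]_(p1, p2)) (eps : R) (Q : probability (obs R p1 p2) R)
    (d : measure_display) (Omega : measurableType d)
    (Pr : probability Omega R) (Z : 'I_n -> {RV Pr >-> obs R p1 p2}),
  calA A -> 0 <= eps <= 1 ->
  huber_sample Z eps (P A) Q ->
  exists2 E : set Omega,
    measurable E /\
    E `<=` [set w | frobenius (Ahat (fun i => Z i w) - A) ^+ 2 <=
      C * (sigma ^+ 2 / kappa ^+ 2) *
      Num.max ((r * (p1 + p2))%:R / n%:R) (eps ^+ 2)] &
    ((1 - expR (- (C' * ((r * (p1 + p2))%:R + n%:R * eps ^+ 2))))%:E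
      <= Pr E)%E].
Proof.
have k20 : 0 < k2 by exact: lt_le_trans hk12.
have d20 : 0 < d2 by exact: lt_le_trans hd12.
have [cL [cU [cL0 cLU tv_frob]]] := regression_model_tv hM k20.
have C00 : 0 < 128 * (cU / cL) by rewrite mulr_gt0// divr_gt0// (lt_le_trans cL0).
have [K [C' [K0 C'0 risk]]] := tournament_risk C00 hd1.
exists 1, (2 * (K / cL) ^+ 2 * (d2 ^+ 2 + 1)), C'; split => //.
  rewrite mulr_gt0//; first by rewrite mulr_gt0// exprn_gt0// divr_gt0.
  by rewrite addr_gt0// exprn_gt0.
move=> n r p1 p2 sigma kappa kappa_u delta Sigma PX r0 p10 p20 sigma0 kappa0 _
  /andP[_ hku] _ lo _ up gPX hn /andP[delta_lo delta_hi] calA P m cover mu p Ahat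
  mc dens win A eps Q d Omega Pr Z SA eps01 hub.
have tvb := tv_frob r p1 p2 sigma kappa kappa_u Sigma PX sigma0 kappa0
  hku lo up gPX.
have g0 : 0 < kappa / sigma by exact: divr_gt0.
set D := (r * (p1 + p2))%N in hn delta_lo delta_hi *.
have D1 : 1 <= D%:R :> R by rewrite (ler_nat R 1 D) muln_gt0 r0 addn_gt0 p10.
have n0R : 0 < n%:R :> R by move: hn; rewrite mul1r; apply: lt_le_trans; lra.
have n0 : (0 < n)%N by rewrite -(ltr0n R).
have Dn0 : 0 < D%:R / n%:R :> R by rewrite divr_gt0//; lra.
have delta0 : 0 < delta.
  by apply: lt_le_trans delta_lo; rewrite mulr_gt0// sqrtr_gt0.
have hD : d1 ^+ 2 * D%:R <= n%:R * delta ^+ 2.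
  have : (d1 * Num.sqrt (D%:R / n%:R)) ^+ 2 <= delta ^+ 2.
    by rewrite lerXn2r ?nnegrE ?(ltW delta0)// mulr_ge0 ?sqrtr_ge0// ltW.
  rewrite exprMn sqr_sqrtr ?(ltW Dn0)// -(ler_pM2l n0R); apply: le_trans.
  rewrite le_eqVlt; apply/orP; left; apply/eqP.
  by field; rewrite lt0r_neq0.
have [[Scover near_cover] _] := mc.
have near : exists j, tv (P A) (P (cover j)) <= delta.
  by have [j hj] := near_cover A SA; exists j; rewrite tv_sym.
have hcount := minimal_cover_local_card p20 cL0 cLU g0
  (fun B (SB : calA B) => proj1 SB) (fun B C SB SC => proj1 (tvb B C SB SC))
  (fun B C SB SC => proj2 (tvb B C SB SC)) delta0 mc SA.
have [E [mE Ewin PrE]] := risk _ _ _ P p mu m cover A n D%:R delta eps Q _ _ Pr Z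
  n0 D1 delta0 hD (fun j => dens _ (Scover j)) near hcount eps01 hub.
exists E => //; split => // w Ew /=.
have hwin := win (fun i => Z i w).
have SAhat : calA (Ahat (fun i => Z i w)) by case: hwin => j -> _; exact: Scover.
have h1 := proj1 (tvb _ _ SAhat SA).
have h2 := Ewin w Ew _ hwin.
rewrite tv_sym in h2.
have eps0 : 0 <= eps by case/andP: eps01.
have := frobenius_risk cL0 g0 (sqrtr_ge0 _) (ltW delta0) eps0 (ltW K0) (ltW Dn0)
  delta_hi h1 h2.
have -> : ((kappa / sigma) ^+ 2)^-1 = sigma ^+ 2 / kappa ^+ 2 by rewrite expr_div_n invf_div.
by [].
Qed.
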